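(* Let $n \in \mathbb{N}$ and let $\{A_i\}_{i \in \mathcal{I}}$ be a finite collection of non-singular real $n \times n$ matrices which are either all diagonal, or all contracting and simultaneously triangularisable. Then the number of phase transitions of the pressure $P : [0,\infty) \to \mathbb{R}$ of $\{A_i\}_{i \in \mathcal{I}}$ is at most $$n + \big(2|\mathcal{I}| - 1\big)\left( \frac{n^3}{8n-4}\binom{2n}{n} - \frac{2^n n}{4} \right).$$
   Context: The index set $\mathcal{I}$ is finite and non-empty with cardinality $|\mathcal{I}|$, and $\mathcal{I}^* = \bigcup_{k \geq 1} \mathcal{I}^k$ is the set of all finite words over $\mathcal{I}$. For $\mathbf{i} = (i_1,\dots,i_k) \in \mathcal{I}^*$ write $A_{\mathbf{i}} = A_{i_1} A_{i_2} \cdots A_{i_k}$, and let $\alpha_1(\mathbf{i}) \geq \dots \geq \alpha_n(\mathbf{i}) > 0$ be the singular values of $A_{\mathbf{i}}$ (the positive square roots of the eigenvalues of $A_{\mathbf{i}}^T A_{\mathbf{i}}$, with multiplicity). A matrix is contracting if it is a contraction of $\mathbb{R}^n$ with the Euclidean norm, i.e. its largest singular value is strictly less than $1$. The matrices are simultaneously triangularisable if there is a basis of $\mathbb{R}^n$ with respect to which all of them are upper triangular, or all of them are lower triangular. For $s \in [0,n)$, the singular value function is $$\phi^s(\mathbf{i}) = \alpha_1(\mathbf{i}) \cdots \alpha_m(\mathbf{i})\, \alpha_{m+1}(\mathbf{i})^{s-m},$$ where $m \in \{0,\dots,n-1\}$ is the unique integer with $m \leq s < m+1$. The pressure $P:[0,\infty)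 \to \mathbb{R}$ of $\{A_i\}_{i\in\mathcal{I}}$ is $$P(s) = \lim_{k \to \infty} \frac{1}{k} \log \sum_{\mathbf{i} \in \mathcal{I}^k} \phi^s(\mathbf{i}) \quad (0 \leq s < n), \qquad P(s) = \log \sum_{i \in \mathcal{I}} |\det A_i|^{s/n} \quad (s \geq n).$$ The limit exists because $\phi^s$ is submultiplicative: $\phi^s(\mathbf{i}\,\mathbf{j}) \leq \phi^s(\mathbf{i})\phi^s(\mathbf{j})$. A real valued function on a domain $D \subseteq \mathbb{R}$ is piecewise real analytic if $D$ can be written as the closure of the union of a finite collection of open (possibly unbounded) intervals such that the function is real analytic on each of these intervals. In the present setting $P$ is piecewise real analytic on $[0,\infty)$. Its phase transitions are the boundary points of these open intervals lying in the interior of $D=[0,\infty)$ such that $P$ is not real analytic on any neighbourhood of the point; equivalently, the points of $(0,\infty)$ having no neighbourhood on which $P$ is real analytic. *)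

(* Defs.v *)
From mathcomp Require Import all_boot all_order all_algebra.
From mathcomp Require Import polyrcf.
From mathcomp Require Import all_classical all_reals all_analysis.

Set Implicit Arguments.
Unset Strict Implicit.
Unset Printing Implicit Defensive.

Import Order.TTheory GRing.Theory Num.Theory.
Import numFieldNormedType.Exports.

Local Open Scope classical_set_scope.
Local Open Scope ring_scope.

(* Real eigenvalues of [M], repeated according to their multiplicity as roots
   of the characteristic polynomial. For symmetric [M] this is the full
   spectrum, of size [n]. *)
Definition eigenvalues (R : realType) (n : nat) (M : 'M[R]_n) : seq R :=
  flatten [seq nseq (mup x (char_poly M)) x | x <- rootsR (char_poly M)].

(* In non-increasing order. *)
Definition singular_values (R : realType) (n : nat) (M : 'M[R]_n) : seq R :=
  sort >=%R [seq Num.sqrt x | x <- eigenvalues (M^T *m M)].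

(* Indices start at 0: the largest singular value is [sigma M 0]. *)
Definition sigma (R : realType) (n : nat) (M : 'M[R]_n) (j : nat) : R :=
  (singular_values M)`_j.

Definition contracting (R : realType) (n : nat) (M : 'M[R]_n) : Prop :=
  sigma M 0 < 1.

Definition lower_triangular (R : realType) (n : nat) (M : 'M[R]_n) : Prop :=
  is_trig_mx M.

Definition upper_triangular (R : realType) (n : nat) (M : 'M[R]_n) : Prop :=
  is_trig_mx M^T.

(* The columns of [B] form the basis of R^n. *)
Definition simultaneously_triangularisable (R : realType) (n : nat)
    (I : finType) (A : I -> 'M[R]_n) : Prop :=
  exists2 B : 'M[R]_n, B \in unitmx &
    (forall i, upper_triangular (invmx B *m A i *m B)) \/
    (forall i, lower_triangular (invmx B *m A i *m B)).

Definition word_mx (R : realType) (n : nat) (I : finType) (A : I -> 'M[R]_n)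
    (k : nat) (w : k.-tuple I) : 'M[R]_n :=
  \big[mulmx/1%:M]_(i <- w) A i.

(* Meaningful for 0 <= s < n only. *)
Definition sv_function (R : realType) (n : nat) (s : R) (M : 'M[R]_n) : R :=
  let m := Num.truncn s in
  (\prod_(j < m) sigma M j) * (sigma M m `^ (s - m%:R)).

(* The values at s < 0 are irrelevant: the domain of the pressure is
   [0, +oo). *)
Definition pressure (R : realType) (n : nat) (I : finType)
    (A : I -> 'M[R]_n) (s : R) : R :=
  if s < n%:R then
    limn (fun k : nat =>
      k%:R^-1 * ln (\sum_(w : k.-tuple I) sv_function s (word_mx A w)))
  else ln (\sum_(i : I) `|\det (A i)| `^ (s / n%:R)).

Definition real_analytic_at (R : realType) (f : R -> R) (x : R) : Prop :=
  exists a : nat -> R, \forall y \near x,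
    series (fun k : nat => a k * (y - x) ^+ k) @ \oo --> f y.

Definition real_analytic_on (R : realType) (U : set R) (f : R -> R) : Prop :=
  forall x, U x -> real_analytic_at f x.

(* Phase transitions of a function with domain [0, +oo). *)
Definition phase_transitions (R : realType) (f : R -> R) : set R :=
  [set x : R | 0 < x /\
    ~ exists U : set R,
        [/\ open_nbhs x U, U `<=` `]0, +oo[ & real_analytic_on U f]].

(* Main.v *)
Require Import Defs.
From mathcomp Require Import all_boot all_order all_fingroup all_algebra.
From mathcomp Require Import finmap polyrcf complex ring lra.
From mathcomp Require Import all_classical all_reals all_analysis.

Set Implicit Arguments.
Unset Strict Implicit.
Unset Printing Implicit Defensive.

Import Order.TTheory GRing.Theory Num.Theory.
Import numFieldNormedType.Exports.

Local Open Scope ring_scope.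

(** The singular value functions are governed by minors. The sum of the squares
    of the [m]-minors of [M] is, by the Cauchy-Binet formula, the sum of the
    principal [m]-minors of [M^T *m M], that is, the [m]-th elementary symmetric
    function of the squared singular values. Hence [sigma_0 * ... * sigma_(m-1)]
    and the sum [minor_norm m M] of the absolute values of the [m]-minors bound
    each other up to constants ([minor_norm_sigma]), and the latter is
    submultiplicative, so that it may be computed in a basis where all the
    matrices are triangular.

    For triangular matrices and [s = m + t] with [0 < t < 1], the [m]-minors and
    the [m.+1]-minors of a word form, once raised to the powers [1 - t] and [t],
    triangular arrays whose diagonal entries are products of diagonal entries of
    the matrices. The sum over the words of length [k] is thus controlled by the
    powers of a triangular nonnegative matrix and grows like its largest diagonal
    entry ([triangular_growth]). That entry is attained at a pair [J, K] with
    [K = j |: J]: word by word, the best [m]-set of diagonal entries completed by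
    the best remaining entry beats every other pair. So on [m < s < m + 1] the
    pressure is the logarithm of the maximum, over the [n * 'C(n - 1, m)] flags
    [(J, j)], of sums of [#|I|] exponentials of [s] ([pressure_triangular]).

    The logarithm of one positive exponential sum is real analytic
    ([real_analytic_ln_expsum]), so a phase transition inside this interval is a
    crossing of two distinct such sums. Their difference has at most [2 * #|I|]
    terms, hence at most [2 * #|I| - 1] zeros ([expsum_zeros]). Beyond [n] there
    is a single exponential sum. Counting the [n] integer points, and
    [2 * #|I| - 1] points for every unordered pair of flags, gives the bound
    ([flag_pairs_total]). *)

(** * Minors and the Cauchy-Binet formula *)

Section Minors.
Variable R : comNzRingType.
Variable n : nat.
Implicit Types (T A B : 'M[R]_n.+1) (J K L : {set 'I_n.+1}).

(** The increasing enumeration of [J]; the default value [ord0] is never reached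
    when [#|J| = m], the only case of interest. *)
Definition elt m J (i : 'I_m) : 'I_n.+1 := nth ord0 (enum J) i.

Definition minor m T J K : R := \det (mxsub (@elt m J) (@elt m K) T).

Lemma elt_in m J (i : 'I_m) : #|J| = m -> elt J i \in J.
Proof. by move=> Jm; rewrite -mem_enum mem_nth // -cardE Jm. Qed.

Lemma elt_inj m J : #|J| = m -> injective (@elt m J).
Proof.
move=> Jm i j /eqP; rewrite nth_uniq ?enum_uniq -?cardE ?Jm //.
by move/eqP/val_inj.
Qed.

Lemma elt_onto m J x : #|J| = m -> x \in J -> {i : 'I_m | elt J i = x}.
Proof.
move=> Jm xJ; have lt : (index x (enum J) < m)%N.
  by rewrite -Jm cardE index_mem mem_enum.
by exists (Ordinal lt); rewrite /elt nth_index // mem_enum.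
Qed.

Lemma big_elt (V : Type) (idx : V) (op : Monoid.com_law idx) m J
    (F : 'I_n.+1 -> V) : #|J| = m ->
  \big[op/idx]_(i < m) F (elt J i) = \big[op/idx]_(j in J) F j.
Proof.
by move=> Jm; rewrite -[RHS]big_enum (big_nth ord0) big_mkord -cardE Jm.
Qed.

Lemma det_mxsub_perm m (h g : 'I_m -> 'I_n.+1) (s : 'S_m) B :
  \det (mxsub (fun i => h (s i)) g B) = (-1) ^+ s * \det (mxsub h g B).
Proof.
rewrite -det_perm -det_mulmx -row_permE; congr (\det _).
by apply/matrixP=> i j; rewrite !mxE.
Qed.

Lemma det_mxsub_mul m (f g : 'I_m -> 'I_n.+1) A B :
  \det (mxsub f g (A *m B)) =
  \sum_(h : {ffun 'I_m -> 'I_n.+1})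
     (\prod_i A (f i) (h i)) * \det (mxsub h g B).
Proof.
pose AB (s : 'S_m) i j := A (f i) j * B j (g (s i)).
transitivity (\sum_(h : {ffun 'I_m -> 'I_n.+1})
    \sum_(s : 'S_m) (-1) ^+ s * \prod_i AB s i (h i)).
  rewrite exchange_big; apply: eq_bigr => /= s _; rewrite -big_distrr /=.
  congr (_ * _); rewrite -(bigA_distr_bigA (AB s)) /=.
  by apply: eq_bigr => x _; rewrite !mxE.
apply: eq_bigr => h _; rewrite big_distrr /=; apply: eq_bigr => s _.
rewrite big_split /= mulrCA; congr (_ * (_ * _)).
by apply: eq_bigr => i _; rewrite !mxE.
Qed.

(** Expanding the rows of the product gives one term for every choice [h] of a
    row of [B] for each row of the minor. A repeated row kills the term, and the
    injective [h] with image [L] are the enumerations of [L] in some order, whose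
    signs rebuild the minor of [A]. *)
Lemma Cauchy_Binet m (f g : 'I_m -> 'I_n.+1) A B :
  \det (mxsub f g (A *m B)) =
  \sum_(L : {set 'I_n.+1} | #|L| == m)
     \det (mxsub f (@elt m L) A) * \det (mxsub (@elt m L) g B).
Proof.
rewrite det_mxsub_mul (bigID (fun h : {ffun _} => injectiveb h)) /=.
rewrite [X in _ + X]big1 ?addr0; last first.
  move=> h /injectivePn[i [j ij hij]].
  rewrite (determinant_alternate ij) ?mulr0 // => k.
  by rewrite !mxE hij.
rewrite (partition_big (fun h : {ffun 'I_m -> 'I_n.+1} => h @: 'I_m)
   (fun L : {set _} => #|L| == m)) /=; last first.
  by move=> h /injectiveP hi; rewrite card_imset // card_ord.
apply: eq_bigr => L /eqP Lm.
pose F (s : 'S_m) := [ffun i => elt L (s i)].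
pose ix (h : {ffun 'I_m -> 'I_n.+1}) :=
  [ffun i : 'I_m => insubd i (index (h i) (enum L)) : 'I_m].
pose G (h : {ffun 'I_m -> 'I_n.+1}) : 'S_m := insubd (1%g : 'S_m) (ix h).
have ltL (x : 'I_n.+1) : x \in L -> (index x (enum L) < m)%N.
  by move=> xL; rewrite -Lm cardE index_mem mem_enum.
have ixE (h : {ffun 'I_m -> 'I_n.+1}) i :
    h i \in L -> val (ix h i) = index (h i) (enum L).
  by move=> hL; rewrite /ix ffunE val_insubd ltL.
rewrite (reindex_onto F G) /=; last first.
  move=> h /andP[/injectiveP hi /eqP hL].
  have hiL i : h i \in L by rewrite -hL imset_f.
  have GE i : G h i = ix h i.
    rewrite /G; have -> : insubd (1%g : 'S_m) (ix h) i = val (insubd (1%g : 'S_m) (ix h)) i.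
      by rewrite /= unlock.
    rewrite val_insubd ifT //.
    apply/injectiveP => a b /(congr1 val); rewrite !ixE // => eab.
    by apply: hi; rewrite -[h a](nth_index ord0 (s := enum L)) ?mem_enum // eab
      nth_index ?mem_enum.
  by apply/ffunP=> i; rewrite ffunE GE /elt ixE // nth_index // mem_enum.
rewrite (eq_bigl xpredT); last first.
  move=> s; have Fi : injective (F s).
    by move=> i j; rewrite !ffunE => /(elt_inj Lm)/perm_inj.
  have FL : F s @: 'I_m = L.
    apply/eqP; rewrite eqEcard card_imset // card_ord Lm leqnn andbT.
    by apply/fintype.subsetP=> _ /imsetP[i _ ->]; rewrite ffunE elt_in.
  rewrite FL eqxx andbT (introT (injectiveP _) Fi) /=; apply/eqP/permP=> i.
  have ixF j : ix (F s) j = s j.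
    apply: val_inj; rewrite ixE ffunE ?elt_in // /elt index_uniq ?enum_uniq //.
    by rewrite -cardE Lm.
  have -> : G (F s) i = val (insubd (1%g : 'S_m) (ix (F s))) i.
    by rewrite /= unlock.
  rewrite val_insubd ifT ?ixF //.
  by apply/injectiveP=> a b; rewrite !ixF => /perm_inj.
rewrite [\det (mxsub f _ A)]/determinant mulr_suml; apply: eq_bigr => s _.
rewrite (_ : mxsub (F s) g B = mxsub (fun i => elt L (s i)) g B); last first.
  by apply/matrixP=> i j; rewrite !mxE ffunE.
rewrite det_mxsub_perm mulrA [_ * (-1) ^+ s]mulrC; congr (_ * _ * _).
by apply: eq_bigr => i _; rewrite !mxE ffunE.
Qed.

Lemma minorM m A B J K :
  minor m (A *m B) J K =
  \sum_(L : {set 'I_n.+1} | #|L| == m) minor m A J L * minor m B L K.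
Proof. exact: Cauchy_Binet. Qed.

Lemma minor_tr m A J K : minor m A^T J K = minor m A K J.
Proof.
rewrite /minor -[RHS]det_tr; congr (\det _).
by apply/matrixP=> i j; rewrite !mxE.
Qed.

(** The trace of the [m]-th compound matrix; up to sign, a coefficient of the
    characteristic polynomial. *)
Definition minor_trace m A := \sum_(J : {set 'I_n.+1} | #|J| == m) minor m A J J.

Lemma minor_traceC m A B : minor_trace m (A *m B) = minor_trace m (B *m A).
Proof.
rewrite /minor_trace; under eq_bigr do rewrite minorM.
rewrite exchange_big /=; apply: eq_bigr => L _; rewrite minorM.
by apply: eq_bigr => J _; rewrite mulrC.
Qed.

(** Inequalities that hold term by term are equalities when the sums compare the
    other way. *)
Lemma monotone_matching m J K (s : 'S_m) (ht : 'I_n.+1 -> nat) :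
  injective ht -> #|J| = m -> #|K| = m ->
  (forall i, (ht (elt J i) <= ht (elt K (s i)))%N) ->
  (\sum_(k in K) ht k <= \sum_(j in J) ht j)%N ->
  forall i, elt J i = elt K (s i).
Proof.
move=> hti Jm Km sP le i; apply: hti; apply/eqP; rewrite eqn_leq sP /=.
rewrite leqNgt; apply/negP=> lt; move: le; rewrite leqNgt => /negP; apply.
rewrite -(big_elt _ _ Jm) -(big_elt _ _ Km) [X in (_ < X)%N](reindex_inj (@perm_inj _ s)) /=.
rewrite (bigD1 i) //= [X in (_ < X)%N](bigD1 i) //= -addSn.
by apply: leq_add lt _; apply: leq_sum => j _; apply: sP.
Qed.

(** For a matrix whose nonzero entries never decrease the height, only the
    matchings that never decrease it contribute to a minor. *)
Lemma minor_neq0 m T J K (ht : 'I_n.+1 -> nat) : injective ht ->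
  (forall i j, T i j != 0 -> (ht i <= ht j)%N) ->
  #|J| = m -> #|K| = m -> minor m T J K != 0 ->
  J = K \/ (\sum_(j in J) ht j < \sum_(k in K) ht k)%N.
Proof.
move=> hti Tht Jm Km nz.
have [s sP] : exists s : 'S_m, forall i, (ht (elt J i) <= ht (elt K (s i)))%N.
  have /existsP[s sP] : [exists s : 'S_m,
      [forall i, T (elt J i) (elt K (s i)) != 0]].
    apply: contraR nz; rewrite negb_exists => /forallP h.
    rewrite /minor /determinant big1 // => s _.
    have /forallPn[k] := h s; rewrite negbK => /eqP Tk.
    by rewrite (bigD1 k) //= !mxE Tk mul0r mulr0.
  by exists s => i; apply/Tht/(forallP sP).
have [le|] := leqP (\sum_(k in K) ht k) (\sum_(j in J) ht j); last by right.
left; have e := monotone_matching hti Jm Km sP le.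
apply/eqP; rewrite eqEcard Jm Km leqnn andbT; apply/fintype.subsetP=> x xJ.
by have [i <-] := elt_onto Jm xJ; rewrite e elt_in.
Qed.

Lemma minor_diag m T J (ht : 'I_n.+1 -> nat) : injective ht ->
  (forall i j, T i j != 0 -> (ht i <= ht j)%N) ->
  #|J| = m -> minor m T J J = \prod_(j in J) T j j.
Proof.
move=> hti Tht Jm; rewrite /minor /determinant (bigD1 (1%g : 'S_m)) //=.
rewrite odd_perm1 expr0 mul1r [X in _ + X]big1 ?addr0.
  rewrite -(big_elt _ (fun j => T j j) Jm) /=.
  by apply: eq_bigr => i _; rewrite !mxE perm1.
move=> s s1; have [/forallP sP|] :=
    boolP [forall i, T (elt J i) (elt J (s i)) != 0].
  case/eqP: s1; apply/permP=> i; rewrite perm1.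
  apply/esym/(elt_inj Jm); apply: (monotone_matching hti) => // k.
  exact/Tht/sP.
move=> /forallPn[k]; rewrite negbK => /eqP Tk.
by rewrite (bigD1 k) //= !mxE Tk mul0r mulr0.
Qed.

Lemma minor_trace_diag m (d : 'rV[R]_n.+1) :
  minor_trace m (diag_mx d) =
  \sum_(J : {set 'I_n.+1} | #|J| == m) \prod_(j in J) d 0 j.
Proof.
apply: eq_bigr => J /eqP Jm.
rewrite (@minor_diag m (diag_mx d) J (@nat_of_ord _)) //; first last.
- by move=> i j; rewrite mxE; have [->|] := eqVneq i j; rewrite ?mulr0n ?eqxx.
- exact: val_inj.
by apply: eq_bigr => j _; rewrite mxE eqxx mulr1n.
Qed.

Lemma minor_map (S : comNzRingType) (f : {rmorphism R -> S}) m T J K :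
  \det (mxsub (@elt m J) (@elt m K) (map_mx f T)) = f (minor m T J K).
Proof.
rewrite /minor -det_map_mx; congr (\det _).
by apply/matrixP=> i j; rewrite !mxE.
Qed.

End Minors.

(** * Singular values and minors *)

Section SingularValues.
Variable R : realType.
Variable n : nat.
Implicit Types (T : 'M[R]_n.+1) (J K L : {set 'I_n.+1}).

Lemma char_poly_conj (F : fieldType) k (P D : 'M[F]_k) : P \in unitmx ->
  char_poly (invmx P *m D *m P) = char_poly D.
Proof.
move=> Pu; pose C := map_mx (@polyC F).
have PVP : C _ _ (invmx P) *m C _ _ P = 1%:M by rewrite -map_mxM mulVmx // map_mx1.
rewrite /char_poly; have -> : char_poly_mx (invmx P *m D *m P) =
    C _ _ (invmx P) *m char_poly_mx D *m C _ _ P.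
  rewrite /char_poly_mx mulmxBr mulmxBl !map_mxM; congr (_ - _).
  by rewrite scalar_mxC -mulmxA PVP mulmx1.
rewrite !det_mulmx mulrAC -det_mulmx PVP det1 mul1r //.
Qed.

Lemma minor_trace_conj (F : fieldType) m (P D : 'M[F]_n.+1) : P \in unitmx ->
  minor_trace m (invmx P *m D *m P) = minor_trace m D.
Proof. by move=> Pu; rewrite minor_traceC mulmxA mulmxV // mul1mx. Qed.

(** A real symmetric matrix is unitarily similar, over the complex numbers, to a
    real diagonal matrix; its characteristic polynomial and its minor traces are
    invariant under similarity, so both can be read off the diagonal. *)
Lemma symmetric_spectrum (S : 'M[R]_n.+1) : S^T = S ->
  exists2 d : 'rV[R]_n.+1, char_poly S = \prod_i ('X - (d 0 i)%:P) &
    forall m, minor_trace m S =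
      \sum_(J : {set 'I_n.+1} | #|J| == m) \prod_(j in J) d 0 j.
Proof.
move=> Ssym; pose f : {rmorphism R -> R[i]} := real_complex R; pose SC := map_mx f S.
have fC (x : R) : (f x)^* = f x.
  exact: conjc_real.
have SCh : SC \is hermsymmx.
  apply/is_hermitianmxP; rewrite expr0 scale1r; apply/matrixP=> i j.
  by rewrite !mxE fC -[in RHS]Ssym mxE.
have /hermitian_normalmx /orthomx_spectralP SCE := SCh.
have /mxOverP spR := hermitian_spectral_diag_real SCh.
have Pu := spectral_unit SC.
move: SCE spR Pu; set P := spectralmx SC; set sp := spectral_diag SC => SCE spR Pu.
pose d := map_mx (@complex.Re R) sp.
have spE : sp = map_mx f d.
  apply/matrixP=> i j; rewrite [RHS]mxE [d _ _]mxE; apply/esym/RRe_real/spR.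
exists d => [|m].
  apply: (@map_inj_poly _ _ f (@complexI R) (rmorph0 _)).
  rewrite map_char_poly -/SC SCE char_poly_conj // char_poly_trig ?diag_mx_is_trig //.
  rewrite rmorph_prod; apply: eq_bigr => i _.
  by rewrite rmorphB /= map_polyX map_polyC /= mxE eqxx mulr1n spE mxE.
apply: (@complexI R); rewrite -[LHS]/(f _) -[RHS]/(f _); have := minor_trace_conj m (diag_mx sp) Pu.
rewrite -SCE minor_trace_diag => tr; rewrite [RHS]rmorph_sum.
transitivity (minor_trace m SC).
  by rewrite /minor_trace rmorph_sum; apply: eq_bigr => J _; rewrite -minor_map.
rewrite tr; apply: eq_bigr => J _; rewrite rmorph_prod.
by apply: eq_bigr => j _; rewrite spE mxE.
Qed.

(** For a row eigenvector [v], the squared norm of [v *m T^T] is [a] times that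
    of [v]. *)
Lemma gram_eigenvalue_ge0 T a : root (char_poly (T^T *m T)) a -> 0 <= a.
Proof.
rewrite -eigenvalue_root_char => /eigenvalueP[v vS v0].
pose q (u : 'rV[R]_n.+1) := (u *m u^T) 0 0.
have qE u : q u = \sum_j u 0 j ^+ 2.
  by rewrite /q mxE; apply: eq_bigr => j _; rewrite mxE expr2.
have q0 u : 0 <= q u by rewrite qE sumr_ge0 // => j _; rewrite sqr_ge0.
have qv : 0 < q v.
  have [j vj] : exists j, v 0 j != 0.
    apply/existsP; apply: contraR v0; rewrite negb_exists => /forallP h.
    by apply/eqP/rowP=> j; rewrite !mxE; apply/eqP; have := h j; rewrite negbK.
  rewrite qE (bigD1 j) //= ltr_pwDl ?exprn_even_gt0 //.
  by rewrite sumr_ge0 // => k _; rewrite sqr_ge0.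
have : q (v *m T^T) = a * q v.
  by rewrite /q trmx_mul trmxK mulmxA -[v *m _ *m T]mulmxA vS -scalemxAl mxE.
by move=> e; rewrite -(pmulr_lge0 _ qv) -e.
Qed.

(** Both lists count every point with its multiplicity as a root. *)
Lemma eigenvalues_perm_eq (S : 'M[R]_n.+1) (d : 'rV[R]_n.+1) :
  char_poly S = \prod_i ('X - (d 0 i)%:P) ->
  perm_eq (eigenvalues S) [seq d 0 i | i <- enum 'I_n.+1].
Proof.
move=> pE; set t := map _ _.
have {}pE : char_poly S = \prod_(x <- t) ('X - x%:P).
  by rewrite pE /t big_map big_enum.
have p0 : char_poly S != 0 by rewrite monic_neq0 ?char_poly_monic.
apply/allP => x _ /=; apply/eqP; rewrite /eigenvalues.
rewrite count_flatten -map_comp sumnE big_map.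
have rootE y : (y \in rootsR (char_poly S)) = (y \in t).
  by rewrite -[RHS]root_prod_XsubC -pE -(roots_on_rootsR p0) in_itv.
rewrite (eq_bigr (fun y => ((x == y) * mup y (char_poly S))%N)); last first.
  by move=> y _; rewrite /= count_nseq /= eq_sym.
have [xt|xt] := boolP (x \in t).
  rewrite (bigD1_seq x) ?rootE ?uniq_roots //= eqxx mul1n big1 ?addn0.
    by rewrite pE mu_prod_XsubC.
  by move=> y /negPf yx; rewrite eq_sym yx.
rewrite big1_seq; first by apply/esym/count_memPn.
move=> y /= /[!rootE] yt; case: eqP => // xy.
by rewrite xy yt in xt.
Qed.

Lemma sigma_ge0 T j : 0 <= sigma T j.
Proof.
rewrite /sigma; have [lt|le] := ltnP j (size (singular_values T)).
  have : (singular_values T)`_j \in singular_values T by rewrite mem_nth.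
  by rewrite mem_sort => /mapP[x _ ->]; apply: sqrtr_ge0.
by rewrite nth_default.
Qed.

Lemma sigma_nonincreasing T i j : (i <= j)%N -> sigma T j <= sigma T i.
Proof.
move=> ij; have [lt|le] := ltnP j (size (singular_values T)); last first.
  by rewrite {1}/sigma nth_default // sigma_ge0.
apply: (@sorted_leq_nth _ >=%R _ _ 0 (singular_values T)) => //.
- by move=> a b c ab bc; apply: le_trans bc ab.
- by move=> a; apply: lexx.
- by apply: sort_sorted => a b; apply: le_total.
- by rewrite inE (leq_ltn_trans ij).
Qed.

Lemma singular_spectrum T (d : 'rV[R]_n.+1) :
  char_poly (T^T *m T) = \prod_i ('X - (d 0 i)%:P) ->
  exists p : 'S_n.+1, forall i, d 0 (p i) = sigma T i ^+ 2.
Proof.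
move=> dE; have d0 i : 0 <= d 0 i.
  apply: (@gram_eigenvalue_ge0 T); rewrite dE /root horner_prod (bigD1 i) //=.
  by rewrite !hornerE subrr mul0r.
pose t := [tuple Num.sqrt (d 0 i) | i < n.+1].
have pe : perm_eq (singular_values T) t.
  rewrite perm_sort /=; apply: perm_trans (perm_map _ (eigenvalues_perm_eq dE)) _.
  by rewrite -map_comp.
have /tuple_permP[p pE] := pe; exists p => i.
rewrite /sigma pE (nth_map i) ?size_enum_ord //.
by rewrite nth_ord_enum tnth_mktuple sqr_sqrtr.
Qed.

(** A set with [m.+1] elements contains some [x >= m]; remove it and compare
    [s x] with [s m]. *)
Lemma leq_prod_nonincreasing (s : nat -> R) : (forall i, 0 <= s i) ->
  (forall i j, (i <= j)%N -> s j <= s i) -> forall J,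
  \prod_(j in J) s j <= \prod_(j < #|J|) s j.
Proof.
move=> s0 sd J; move: {2}#|J| (erefl #|J|) => m; elim: m J => [|m IH] J Jm.
  by rewrite (cards0_eq Jm) big_set0 cards0 big_ord0.
have /existsP[x /andP[xJ mx]] : [exists x, (x \in J) && (m <= x)%N].
  apply: contraT; rewrite negb_exists => /forallP h.
  have : (size (map val (enum J)) <= size (iota 0 m))%N.
    apply: uniq_leq_size; first by rewrite map_inj_uniq ?enum_uniq //; apply: val_inj.
    move=> _ /mapP[x + ->]; rewrite mem_enum => xJ; rewrite mem_iota /= add0n.
    by have := h x; rewrite xJ /= -ltnNge.
  by rewrite size_map -cardE size_iota Jm ltnn.
have Jx : #|J :\ x| = m by apply/eqP; rewrite -eqSS -Jm (cardsD1 x J) xJ.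
rewrite Jm big_ord_recr (big_setD1 x) //= mulrC ler_pM ?prodr_ge0 //.
  by rewrite -Jx; apply: IH; rewrite Jx.
exact: sd.
Qed.

(** The entrywise 1-norm of the [m]-th compound matrix. *)
Definition minor_norm m T : R :=
  \sum_(J : {set 'I_n.+1} | #|J| == m) \sum_(K : {set 'I_n.+1} | #|K| == m)
    `|minor m T J K|.

Lemma minor_norm_ge0 m T : 0 <= minor_norm m T.
Proof. by apply: sumr_ge0 => J _; apply: sumr_ge0 => K _. Qed.

Lemma ler_minor_norm m T J K : #|J| = m -> #|K| = m ->
  `|minor m T J K| <= minor_norm m T.
Proof.
move=> Jm Km; rewrite /minor_norm (bigD1 J) ?Jm //= (bigD1 K) ?Km //= -addrA lerDl.
by apply: addr_ge0; apply: sumr_ge0 => // L _; apply: sumr_ge0.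
Qed.

Lemma minor_normM m A B :
  minor_norm m (A *m B) <= minor_norm m A * minor_norm m B.
Proof.
rewrite {1}/minor_norm; apply: (@le_trans _ _ (\sum_(J : {set 'I_n.+1} | #|J| == m)
  \sum_(K : {set 'I_n.+1} | #|K| == m) \sum_(L : {set 'I_n.+1} | #|L| == m)
   `|minor m A J L| * `|minor m B L K|)).
  apply: ler_sum => J _; apply: ler_sum => K _; rewrite minorM.
  by apply: le_trans (ler_norm_sum _ _ _) _; under eq_bigr do rewrite normrM.
rewrite {1}/minor_norm mulr_suml; apply: ler_sum => J _.
rewrite exchange_big mulr_suml /=; apply: ler_sum => L Lm.
rewrite -mulr_sumr ler_wpM2l // /minor_norm [leRHS](bigD1 L) //= lerDl.
by apply: sumr_ge0 => K _; apply: sumr_ge0.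
Qed.

(** The sum [G] of the squared minors is the [m]-th elementary symmetric function
    of the squared singular values: its largest term is the square of the product
    of the [m] largest ones, and it has at most [#|{set 'I_n.+1}|] terms. *)
Lemma minor_norm_sigma m T : (m <= n.+1)%N ->
  \prod_(j < m) sigma T j <= minor_norm m T <=
  #|{set 'I_n.+1}|%:R ^+ 3 * \prod_(j < m) sigma T j.
Proof.
move=> mn; set phi := \prod_(j < m) _; set c : R := #|_|%:R.
have phi0 : 0 <= phi by apply: prodr_ge0 => j _; apply: sigma_ge0.
have c1 : 1 <= c by rewrite /c ler1n; apply/card_gt0P; exists finset.set0.
have c0 : 0 <= c := le_trans ler01 c1.
pose G := minor_trace m (T^T *m T).
have GE : G = \sum_(J : {set 'I_n.+1} | #|J| == m)
    \sum_(K : {set 'I_n.+1} | #|K| == m) minor m T J K ^+ 2.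
  rewrite exchange_big; apply: eq_bigr => K _; rewrite minorM.
  by apply: eq_bigr => J _; rewrite minor_tr expr2.
have [d dE] := symmetric_spectrum (S := T^T *m T) ltac:(by rewrite trmx_mul trmxK).
have [p pE] := singular_spectrum dE.
move=> /(_ m); rewrite -/G (reindex_inj (imset_inj (@perm_inj _ p))) /=.
rewrite (eq_bigl (fun J : {set 'I_n.+1} => #|J| == m)); last first.
  by move=> J; rewrite card_imset //; apply: perm_inj.
rewrite (eq_bigr (fun J : {set 'I_n.+1} => (\prod_(j in J) sigma T j) ^+ 2)); last first.
  move=> J _; rewrite big_imset /=; last by move=> x y _ _; apply: perm_inj.
  by rewrite -prodrXl; apply: eq_bigr.
move=> G2.
have Gle : G <= c * phi ^+ 2.
  rewrite G2 (@le_trans _ _ (\sum_(J : {set 'I_n.+1} | #|J| == m) phi ^+ 2)) //.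
    apply: ler_sum => J /eqP Jm; rewrite lerXn2r ?nnegrE //.
      by apply: prodr_ge0 => j _; apply: sigma_ge0.
    rewrite /phi -Jm; apply: leq_prod_nonincreasing; first exact: sigma_ge0.
    exact: sigma_nonincreasing.
  rewrite sumr_const -[_ *+ _]mulr_natl ler_wpM2r ?sqr_ge0 // ler_nat.
  exact: max_card.
have Gge : phi ^+ 2 <= G.
  pose J0 : {set 'I_n.+1} := widen_ord mn @: 'I_m.
  have inj : injective (widen_ord mn) by move=> i j /(congr1 val) /= e; apply: val_inj.
  have J0m : #|J0| == m by rewrite card_imset // card_ord.
  have J0E : \prod_(j in J0) sigma T j = phi.
    by rewrite big_imset //= => x y _ _ /inj.
  rewrite G2 (bigD1 J0) //= J0E.
  by rewrite lerDl sumr_ge0 // => J _; rewrite sqr_ge0.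
apply/andP; split.
  rewrite -(@ler_pXn2r _ 2) ?nnegrE ?minor_norm_ge0 //.
  apply: (le_trans Gge); rewrite GE expr2 {2}/minor_norm mulr_suml.
  apply: ler_sum => J /eqP Jm; rewrite mulr_suml; apply: ler_sum => K /eqP Km.
  by rewrite -real_normK ?num_real // expr2 ler_wpM2l // ler_minor_norm.
have mle J K : #|J| == m -> #|K| == m -> `|minor m T J K| <= c * phi.
  move=> Jm Km; rewrite -(@ler_pXn2r _ 2) ?nnegrE ?mulr_ge0 //.
  rewrite real_normK ?num_real //; apply: (@le_trans _ _ G).
    rewrite GE (bigD1 J) //= (bigD1 K) //= -addrA lerDl.
    by apply: addr_ge0; apply: sumr_ge0 => L _; rewrite ?sqr_ge0 //;
      apply: sumr_ge0 => ? _; rewrite sqr_ge0.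
  apply: (le_trans Gle); rewrite exprMn ler_wpM2r ?sqr_ge0 // expr2.
  by rewrite ler_peMl.
have sle (x : R) : 0 <= x -> \sum_(J : {set 'I_n.+1} | #|J| == m) x <= c * x.
  move=> x0; rewrite sumr_const -mulr_natl ler_wpM2r // ler_nat.
  exact: max_card.
have cp : 0 <= c * phi := mulr_ge0 c0 phi0.
rewrite /minor_norm exprS expr2 -!mulrA.
have ccp : 0 <= c * (c * phi) := mulr_ge0 c0 cp.
apply: le_trans (sle _ ccp).
apply: ler_sum => J Jm; apply: le_trans (sle _ cp).
by apply: ler_sum => K Km; apply: mle.
Qed.

End SingularValues.

(** * Exponential growth of sums over words *)

Section Growth.
Variable R : realType.

Lemma sum_tupleS (I : finType) (V : nmodType) k (F : k.+1.-tuple I -> V) :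
  \sum_w F w = \sum_i \sum_(w : k.-tuple I) F (cons_tuple i w).
Proof.
rewrite pair_big /=.
rewrite (reindex (fun p : I * k.-tuple I => cons_tuple p.1 p.2)) //=.
exists (fun w : k.+1.-tuple I => (thead w, [tuple of behead w])) => [[i w]|w] _ /=.
  by rewrite theadE; congr pair; apply: val_inj.
by rewrite [RHS]tuple_eta.
Qed.

Lemma sum_tuple0 (I : finType) (V : nmodType) (F : 0.-tuple I -> V) :
  \sum_w F w = F [tuple].
Proof.
by rewrite (big_pred1 [tuple]) // => w; apply/esym/eqP/tuple0.
Qed.

Lemma sum_tuple_prod (I : finType) k (F : I -> R) :
  \sum_(w : k.-tuple I) \prod_(i <- w) F i = (\sum_i F i) ^+ k.
Proof.
elim: k => [|k IH]; first by rewrite sum_tuple0 big_nil expr0.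
rewrite sum_tupleS exprS mulr_suml; apply: eq_bigr => i _.
by rewrite -IH mulr_sumr; apply: eq_bigr => w _; rewrite big_cons.
Qed.

(** Each of [x / (x + y)] and [y / (x + y)] is at most its own [u]-th power. *)
Lemma powR_subadd (u x y : R) : 0 < u <= 1 -> 0 <= x -> 0 <= y ->
  (x + y) `^ u <= x `^ u + y `^ u.
Proof.
move=> /andP[u0 u1] x0 y0; have [z0|z0] := eqVneq (x + y) 0.
  by rewrite z0 powR0 ?gt_eqF // addr_ge0 ?powR_ge0.
have zp : 0 < x + y by rewrite lt_neqAle eq_sym z0 addr_ge0.
have frac a : 0 <= a -> a <= x + y -> (x + y) `^ u * (a / (x + y)) <= a `^ u.
  move=> a0 az; have [->|an0] := eqVneq a 0; first by rewrite mul0r mulr0 powR_ge0.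
  have ap : 0 < a by rewrite lt_neqAle eq_sym an0.
  rewrite -{2}(divfK z0 a) mulrC [leRHS]powRM ?divr_ge0 ?(ltW zp) //.
  rewrite ler_wpM2r ?powR_ge0 // ger1_powR // divr_gt0 //=.
  by rewrite ler_pdivrMr // mul1r.
have /le_trans -> // : (x + y) `^ u <=
    (x + y) `^ u * (x / (x + y)) + (x + y) `^ u * (y / (x + y)).
  by rewrite -mulrDr -mulrDl divff // mulr1.
by apply: lerD; apply: frac => //; rewrite ?lerDl ?lerDr.
Qed.

Lemma powR_sum_le (T : finType) (P : pred T) (u : R) (F : T -> R) :
  0 < u <= 1 -> (forall i, 0 <= F i) ->
  (\sum_(i | P i) F i) `^ u <= \sum_(i | P i) F i `^ u.
Proof.
move=> u01 F0.
suff [] : 0 <= \sum_(i | P i) F i /\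
    (\sum_(i | P i) F i) `^ u <= \sum_(i | P i) F i `^ u by [].
apply: (big_rec2 (fun x y => 0 <= x /\ x `^ u <= y)).
  by rewrite powR0 // gt_eqF //; case/andP: u01.
move=> i x y _ [x0 xy]; split; first exact: addr_ge0.
by apply: le_trans (powR_subadd u01 (F0 i) x0) _; rewrite lerD2l.
Qed.

Lemma powR_prod (T : Type) (r : seq T) (P : pred T) (u : R) (F : T -> R) :
  (forall i, 0 <= F i) ->
  (\prod_(i <- r | P i) F i) `^ u = \prod_(i <- r | P i) F i `^ u.
Proof.
move=> F0; elim: r => [|i r IH]; first by rewrite !big_nil powR1.
rewrite !big_cons; case: ifP => // Pi.
by rewrite powRM ?IH // prodr_ge0.
Qed.

(** Weighting the index [b] by [delta ^+ h b] makes the entries off the diagonal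
    negligible, so that the weight vector is almost an eigenvector for the
    largest diagonal entry. *)
Lemma triangular_growth (I X : finType) (ent : I -> X -> X -> R)
    (ew : seq I -> X -> X -> R) (h : X -> nat) (rho r : R) :
  (forall i a b, 0 <= ent i a b) ->
  (forall w a b, 0 <= ew w a b) ->
  (forall a b, ew [::] a b <= (a == b)%:R) ->
  (forall i w a b, ew (i :: w) a b <= \sum_c ent i a c * ew w c b) ->
  (forall i a b, ent i a b != 0 -> a = b \/ (h a < h b)%N) ->
  (forall a, \sum_i ent i a a <= rho) -> 0 <= rho -> rho < r ->
  exists C, forall k,
    \sum_(w : k.-tuple I) \sum_a \sum_b ew w a b <= C * r ^+ k.
Proof.
move=> ent0 ew0 ew_nil ew_cons hent diag rho0 rho_r.
have r0 : 0 < r by apply: le_lt_trans rho_r.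
pose S := \sum_i \sum_a \sum_b ent i a b.
have S0 : 0 <= S by do 3![apply: sumr_ge0 => ? _].
pose delta := Num.min 1 ((r - rho) / (S + 1)).
have S1 : 0 < S + 1 by rewrite ltr_wpDl.
have d0 : 0 < delta by rewrite lt_min ltr01 divr_gt0 // subr_gt0.
have d1 : delta <= 1 by rewrite ge_min lexx.
have dS : delta * S <= r - rho.
  have : delta <= (r - rho) / (S + 1) by rewrite ge_min lexx orbT.
  rewrite ler_pdivlMr // => /(le_trans _); apply.
  by rewrite ler_wpM2l ?(ltW d0) // lerDl.
pose v a := delta ^+ h a.
have v0 a : 0 < v a by rewrite exprn_gt0.
have vstep a : \sum_i \sum_c ent i a c * v c <= r * v a.
  have H i c : ent i a c * v c <= (c == a)%:R * (ent i a a * v a) + delta * ent i a c * v a.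
    have [->|ca] := eqVneq c a; first by rewrite mul1r lerDl !mulr_ge0 // ltW.
    rewrite mul0r add0r; have [->|nz] := eqVneq (ent i a c) 0.
      by rewrite mulr0 !mul0r.
    have [e|lt] := hent _ _ _ nz; first by rewrite e eqxx in ca.
    rewrite [leRHS]mulrAC [leRHS]mulrC ler_wpM2l // /v -exprS.
    by rewrite ler_wiXn2l // ltW.
  apply: (@le_trans _ _ (\sum_i (ent i a a * v a + delta * (\sum_c ent i a c) * v a))).
    apply: ler_sum => i _; apply: (@le_trans _ _
      (\sum_c ((c == a)%:R * (ent i a a * v a) + delta * ent i a c * v a))).
      by apply: ler_sum => c _; apply: H.
    rewrite big_split /= (bigD1 a) //= eqxx mul1r big1 ?addr0; last first.
      by move=> c /negPf ->; rewrite mul0r.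
    by rewrite lerD2l mulr_sumr mulr_suml.
  rewrite big_split /= -!mulr_suml -mulrDl ler_wpM2r ?(ltW (v0 _)) //.
  rewrite -mulr_sumr -lerBrDl; apply: (@le_trans _ _ (r - rho)); last first.
    by rewrite lerD2l lerN2.
  apply: le_trans dS; rewrite ler_wpM2l ?(ltW d0) //.
  apply: ler_sum => i _; rewrite [leRHS](bigD1 a) //= lerDl.
  by apply: sumr_ge0 => b _; apply: sumr_ge0.
pose V k a := \sum_(w : k.-tuple I) \sum_b ew w a b * v b.
have Vle k a : V k a <= r ^+ k * v a.
  elim: k a => [|k IH] a.
    rewrite /V sum_tuple0 /= expr0 mul1r.
    apply: (@le_trans _ _ (\sum_b (a == b)%:R * v b)).
      by apply: ler_sum => b _; rewrite ler_wpM2r ?ew_nil // ltW.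
    rewrite (bigD1 a) //= eqxx mul1r big1 ?addr0 // => b.
    by rewrite eq_sym => /negPf ->; rewrite mul0r.
  rewrite /V sum_tupleS; apply: (@le_trans _ _ (\sum_i \sum_c ent i a c * V k c)).
    apply: ler_sum => i _; under [leRHS]eq_bigr do rewrite mulr_sumr.
    rewrite [leRHS]exchange_big /=; apply: ler_sum => w _.
    under [leRHS]eq_bigr do rewrite mulr_sumr.
    rewrite [leRHS]exchange_big /=; apply: ler_sum => b _.
    under eq_bigr do rewrite mulrA.
    by rewrite -mulr_suml ler_wpM2r ?ew_cons // ltW.
  apply: (@le_trans _ _ (\sum_i \sum_c r ^+ k * (ent i a c * v c))).
    apply: ler_sum => i _; apply: ler_sum => c _.
    by rewrite mulrCA ler_wpM2l.
  under eq_bigr do rewrite -mulr_sumr.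
  rewrite -mulr_sumr exprSr -mulrA ler_wpM2l ?vstep //.
  by rewrite exprn_ge0 // ltW.
pose H := (\max_a h a)%N.
exists (\sum_a (delta ^+ H)^-1 * v a) => k; rewrite exchange_big /= mulr_suml.
apply: ler_sum => a _; rewrite mulrAC -mulrA ler_pdivlMl ?exprn_gt0 //.
apply: le_trans (Vle k a); rewrite mulr_sumr; apply: ler_sum => w _.
rewrite mulr_sumr; apply: ler_sum => b _; rewrite mulrC ler_wpM2l //.
by rewrite /v ler_wiXn2l ?(ltW d0) // leq_bigmax.
Qed.

(** Otherwise the difference of the logarithms, multiplied by [k], would exceed
    [ln N]. *)
Lemma exp_growth_le (x y N : R) : 0 < y -> 0 < N ->
  (forall k : nat, x ^+ k <= N * y ^+ k) -> x <= y.
Proof.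
move=> y0 N0 H; have [x0|x0] := leP x 0; first exact/ltW/(le_lt_trans x0).
rewrite leNgt; apply/negP => yx; have lt : ln y < ln x by rewrite ltr_ln.
pose k := (Num.truncn (ln N / (ln x - ln y))).+1.
have : ln (x ^+ k) <= ln (N * y ^+ k).
  by rewrite ler_ln ?posrE ?exprn_gt0 ?mulr_gt0 ?exprn_gt0.
rewrite lnM ?posrE ?exprn_gt0 // !lnXn // -lerBlDr -mulrnBl -mulr_natl.
rewrite -ler_pdivlMr ?subr_gt0 // leNgt.
by move/negP; apply; apply: truncnS_gt.
Qed.

(** After taking logarithms and dividing by [k], the constants disappear. *)
Lemma growth_rate (Z : nat -> R) (rho c : R) : 0 < rho -> 0 < c ->
  (forall k, c * rho ^+ k <= Z k) ->
  (forall r, rho < r -> exists C, forall k, Z k <= C * r ^+ k) ->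
  ((fun k => k%:R^-1 * ln (Z k)) @ \oo --> ln rho)%classic.
Proof.
move=> rho0 c0 lower upper; apply/cvgrPdist_le => e e0.
pose r := rho * expR (e / 2).
have rr : rho < r by rewrite ltr_pMr // expR_gt1 divr_gt0.
have r0 : 0 < r := lt_trans rho0 rr.
have [C HC] := upper _ rr.
have C0 : 0 < C.
  have := le_trans (lower 0%N) (HC 0%N).
  by rewrite !expr0 !mulr1; apply: lt_le_trans.
have Z0 k : 0 < Z k by apply: lt_le_trans (lower k); rewrite mulr_gt0 ?exprn_gt0.
pose B := `|ln c| + `|ln C|.
near=> k.
have k0 : 0 < k%:R :> R by rewrite ltr0n; near: k; exists 1%N.
have kB : B <= k%:R * (e / 2).
  rewrite -ler_pdivrMr ?divr_gt0 //; near: k; exact: nbhs_infty_ger.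
have L1 : ln c + k%:R * ln rho <= ln (Z k).
  rewrite mulr_natl -lnXn // -lnM ?posrE ?exprn_gt0 //.
  by rewrite ler_ln ?posrE ?mulr_gt0 ?exprn_gt0.
have L2 : ln (Z k) <= ln C + k%:R * (ln rho + e / 2).
  have -> : ln rho + e / 2 = ln r by rewrite lnM ?posrE ?expR_gt0 // expRK.
  rewrite mulr_natl -lnXn // -lnM ?posrE ?exprn_gt0 //.
  by rewrite ler_ln ?posrE ?mulr_gt0 ?exprn_gt0.
have c1 : - B <= ln c.
  have := ler_norm (- ln c); have := normr_ge0 (ln C); rewrite normrN /B; lra.
have c2 : ln C <= B.
  have := ler_norm (ln C); have := normr_ge0 (ln c); rewrite /B; lra.
have -> : ln rho - k%:R^-1 * ln (Z k) = k%:R^-1 * (k%:R * ln rho - ln (Z k)).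
  by rewrite mulrBr mulKf // gt_eqF.
rewrite normrM ger0_norm ?invr_ge0 ?(ltW k0) // ler_pdivrMl //.
rewrite ler_norml; apply/andP; split; lra.
Unshelve. all: by end_near. Qed.

End Growth.

(** * Words in triangular matrices *)

Section Triangular.
Variables (R : realType) (n : nat) (I : finType) (T : I -> 'M[R]_n.+1).
(* Stating triangularity through an injective height treats upper and lower
   triangular matrices at once. *)
Variable ht : 'I_n.+1 -> nat.
Hypothesis ht_inj : injective ht.
Hypothesis ht_mono : forall i a b, T i a b != 0 -> (ht a <= ht b)%N.
Hypothesis diag_neq0 : forall i a, T i a a != 0.
Variables (m : nat) (t : R).
Hypothesis m_le_n : (m < n.+1)%N.
Hypothesis t01 : 0 < t < 1.
Hypothesis I_gt0 : (0 < #|I|)%N.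

Let word (w : seq I) : 'M[R]_n.+1 := \big[mulmx/1%:M]_(i <- w) T i.
Let d i a : R := `|T i a a|.
Let D (w : seq I) a : R := \prod_(i <- w) d i a.

(** The pair [(J, j)] stands for the two-step flag [J], [j |: J]. *)
Definition flag (p : {set 'I_n.+1} * 'I_n.+1) := (#|p.1| == m) && (p.2 \notin p.1).

(** The sum over [i] of [d_J ^ (1 - t) * d_K ^ t] for [K = j |: J], where [d_J] is
    the product of the diagonal entries with index in [J]. *)
Definition flag_sum (p : {set 'I_n.+1} * 'I_n.+1) : R :=
  \sum_i (\prod_(l in p.1) d i l) * d i p.2 `^ t.

Let t0 : 0 < t. Proof. by case/andP: t01. Qed.
Let t1 : 0 < 1 - t. Proof. by rewrite subr_gt0; case/andP: t01. Qed.
Let t_range : 0 < t <= 1. Proof. by case/andP: t01 => -> /ltW ->. Qed.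
Let t1_range : 0 < 1 - t <= 1.
Proof. by rewrite t1 gerBl ltW. Qed.

Let d_gt0 i a : 0 < d i a. Proof. by rewrite normr_gt0. Qed.
Let D_gt0 w a : 0 < D w a. Proof. exact: prodr_gt0. Qed.

Let prodD_gt0 w (J : {set 'I_n.+1}) : 0 < \prod_(j in J) D w j.
Proof. exact: prodr_gt0. Qed.

Let word_mono w a b : word w a b != 0 -> (ht a <= ht b)%N.
Proof.
rewrite /word; elim: w a b => [|i w IH] a b.
  by rewrite big_nil mxE; have [->|] := eqVneq a b; rewrite ?eqxx.
rewrite big_cons mxE => nz.
have /existsP[c] : [exists c, T i a c * (\big[mulmx/1%:M]_(j <- w) T j) c b != 0].
  apply: contraR nz; rewrite negb_exists => /forallP h; rewrite big1 // => c _.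
  by apply/eqP; have := h c; rewrite negbK.
by rewrite mulf_eq0 negb_or => /andP[/ht_mono ac /IH]; apply: leq_trans.
Qed.

Let word_diag w a : `|word w a a| = D w a.
Proof.
rewrite /D; elim: w => [|i w IH].
  by rewrite /word !big_nil mxE eqxx normr1.
rewrite big_cons -IH /word big_cons mxE (bigD1 a) //= big1 ?addr0 ?normrM //.
move=> c ca; apply/eqP; apply: contraNT ca.
rewrite mulf_eq0 negb_or => /andP[/ht_mono ac /word_mono ca].
by apply/eqP/ht_inj/eqP; rewrite eqn_leq ca.
Qed.

Let word_minor_diag w k (J : {set 'I_n.+1}) : #|J| = k ->
  `|minor k (word w) J J| = \prod_(j in J) D w j.
Proof.
move=> Jk; rewrite (minor_diag ht_inj _ Jk); last exact: word_mono.
by rewrite normr_prod; apply: eq_bigr => j _; apply: word_diag.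
Qed.

Let T_minor_diag i k (J : {set 'I_n.+1}) : #|J| = k ->
  `|minor k (T i) J J| = \prod_(j in J) d i j.
Proof.
by move=> Jk; rewrite (minor_diag ht_inj _ Jk) ?normr_prod //; apply: ht_mono.
Qed.

Let prodD_exchange w (J : {set 'I_n.+1}) :
  \prod_(j in J) D w j = \prod_(i <- w) \prod_(j in J) d i j.
Proof. exact: exchange_big. Qed.

Let flag_word w (p : {set 'I_n.+1} * 'I_n.+1) :
  \prod_(i <- w) ((\prod_(l in p.1) d i l) * d i p.2 `^ t) =
  (\prod_(l in p.1) D w l) * D w p.2 `^ t.
Proof.
rewrite big_split /= -(prodD_exchange w p.1) -powR_prod //.
by move=> i; apply: ltW.
Qed.

Let Z k := \sum_(w : k.-tuple I)
  minor_norm m (word w) `^ (1 - t) * minor_norm m.+1 (word w) `^ t.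

Let powR_flag (x y : R) : 0 < x -> 0 < y -> x `^ (1 - t) * (x * y) `^ t = x * y `^ t.
Proof.
move=> x0 y0; rewrite powRM ?(ltW x0) ?(ltW y0) // mulrA -powRD ?subrK ?powRr1 //.
  exact: ltW.
by rewrite gt_eqF // implybT.
Qed.

(** Principal minors of triangular matrices are multiplicative, so the sum over
    words of the two principal minors of a flag is an exact power. *)
Lemma flag_sum_le_growth p k : flag p -> flag_sum p ^+ k <= Z k.
Proof.
move=> /andP[/eqP Jm jJ]; rewrite -sum_tuple_prod; apply: ler_sum => w _.
rewrite flag_word -powR_flag //.
have Km : #|p.2 |: p.1| = m.+1 by rewrite cardsU1 jJ Jm.
have KE : \prod_(l in p.1) D w l * D w p.2 = \prod_(l in p.2 |: p.1) D w l.
  by rewrite big_setU1 //= mulrC.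
rewrite KE -(word_minor_diag w Jm) -(word_minor_diag w Km).
rewrite ler_pM ?powR_ge0 //; apply: ge0_ler_powR;
  by rewrite ?nnegrE ?minor_norm_ge0 ?ler_minor_norm // ltW.
Qed.

Let Pair := ({set 'I_n.+1} * {set 'I_n.+1})%type.
Let valid (a : Pair) := (#|a.1| == m) && (#|a.2| == m.+1).

(** Giving the value [0] to sets of the wrong sizes lets the indices of the array
    range over all pairs of sets. *)
Let entry (M : 'M[R]_n.+1) (a b : Pair) : R := if valid a && valid b then
  `|minor m M a.1 b.1| `^ (1 - t) * `|minor m.+1 M a.2 b.2| `^ t else 0.

Let entry_ge0 M a b : 0 <= entry M a b.
Proof. by rewrite /entry; case: ifP => // _; rewrite mulr_ge0 ?powR_ge0. Qed.

Lemma sum_pairM (X Y : finType) (P : pred X) (Q : pred Y) (f : X -> R) (g : Y -> R) :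
  \sum_(p : X * Y | P p.1 && Q p.2) f p.1 * g p.2 =
  (\sum_(x | P x) f x) * (\sum_(y | Q y) g y).
Proof.
rewrite mulr_suml; under [RHS]eq_bigr do rewrite mulr_sumr.
by rewrite pair_big.
Qed.

Let minorM_powR (u : R) k (A B : 'M[R]_n.+1) J K : 0 < u <= 1 -> `|minor k (A *m B) J K| `^ u <=
  \sum_(L : {set 'I_n.+1} | #|L| == k)
    `|minor k A J L| `^ u * `|minor k B L K| `^ u.
Proof.
move=> u01; rewrite minorM.
apply: (@le_trans _ _ ((\sum_(L : {set 'I_n.+1} | #|L| == k)
    `|minor k A J L * minor k B L K|) `^ u)).
  apply: ge0_ler_powR; rewrite ?nnegrE ?sumr_ge0 ?ler_norm_sum //.
  by case/andP: u01 => /ltW.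
apply: le_trans; first by apply: powR_sum_le u01 _ => L; apply: normr_ge0.
by apply: ler_sum => L _; rewrite normrM powRM.
Qed.

(** Since both exponents are at most one, the powers are subadditive, so the
    Cauchy-Binet formula becomes an inequality between nonnegative arrays. *)
Let entryM A B a b : entry (A *m B) a b <= \sum_c entry A a c * entry B c b.
Proof.
rewrite {1}/entry; case: ifPn => [/andP[va vb]|_]; last first.
  by apply: sumr_ge0 => c _; rewrite mulr_ge0.
apply: (@le_trans _ _ (\sum_(c | valid c) entry A a c * entry B c b)); last first.
  rewrite [leRHS](bigID valid) /= lerDl.
  by apply: sumr_ge0 => c _; rewrite mulr_ge0.
pose f L := `|minor m A a.1 L| `^ (1 - t) * `|minor m B L b.1| `^ (1 - t).
pose g L := `|minor m.+1 A a.2 L| `^ t * `|minor m.+1 B L b.2| `^ t.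
rewrite (eq_bigr (fun c => f c.1 * g c.2)); last first.
  by move=> c vc; rewrite /entry va vb vc /= mulrACA.
rewrite (sum_pairM (fun L : {set 'I_n.+1} => #|L| == m)
  (fun L : {set 'I_n.+1} => #|L| == m.+1)).
by rewrite ler_pM ?powR_ge0 // minorM_powR.
Qed.

Let minor1 k (J K : {set 'I_n.+1}) : #|J| = k -> #|K| = k ->
  `|minor k 1%:M J K| = (J == K)%:R :> R.
Proof.
move=> Jk Kk.
have mono1 i j : (1%:M : 'M[R]_n.+1) i j != 0 -> (i <= j)%N.
  by rewrite mxE; have [->|] := eqVneq i j; rewrite ?eqxx.
have inj := @ord_inj n.+1.
have [->|JK] := eqVneq J K.
  rewrite (minor_diag inj mono1) // big1 ?normr1 // => j _.
  by rewrite mxE eqxx.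
apply/eqP; rewrite normr_eq0; apply: contraNT JK => nz.
have [-> //|lt] := minor_neq0 inj mono1 Jk Kk nz.
have nz' : minor k 1%:M K J != 0 :> R by rewrite -[1%:M]trmx1 minor_tr.
have [-> //|lt'] := minor_neq0 inj mono1 Kk Jk nz'.
by have := ltn_trans lt lt'; rewrite ltnn.
Qed.

Let entry1 a b : entry 1%:M a b <= (a == b)%:R.
Proof.
rewrite /entry; case: ifP => [/andP[/andP[/eqP a1 /eqP a2] /andP[/eqP b1 /eqP b2]]|_];
  last by rewrite ler0n.
rewrite !minor1 //; case: a a1 a2 => a1 a2 /=; case: b b1 b2 => b1 b2 /= *.
rewrite xpair_eqE; have [_|_] := eqVneq a1 b1; last first.
  by rewrite powR0 ?gt_eqF // mul0r.
have [_|_] := eqVneq a2 b2; first by rewrite !powR1 mulr1.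
by rewrite powR1 mul1r /= powR0 // gt_eqF.
Qed.

Let height (a : Pair) := (\sum_(j in a.1) ht j + \sum_(j in a.2) ht j)%N.

(** For [0 < t < 1] a vanishing minor stays zero after taking powers. *)
Let entry_height i a b : entry (T i) a b != 0 -> a = b \/ (height a < height b)%N.
Proof.
rewrite /entry; case: ifP; last by rewrite eqxx.
case: a b => [a1 a2] [b1 b2] /andP[/andP[/eqP /= a1m /eqP /= a2m]].
move=> /andP[/eqP /= b1m /eqP /= b2m].
rewrite mulf_eq0 negb_or !powR_eq0 !normr_eq0 !negb_and !negbK (gt_eqF t0) (gt_eqF t1).
rewrite !orbF => /andP[nz1 nz2]; rewrite /height /=.
have [->|lt1] := minor_neq0 ht_inj (@ht_mono i) a1m b1m nz1;
have [->|lt2] := minor_neq0 ht_inj (@ht_mono i) a2m b2m nz2.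
- by left.
- by right; rewrite ltn_add2l.
- by right; rewrite ltn_add2r.
- by right; rewrite -addSn leq_add // ltnW.
Qed.

Let growth_le_entries w :
  minor_norm m (word w) `^ (1 - t) * minor_norm m.+1 (word w) `^ t <=
  \sum_a \sum_b entry (word w) a b.
Proof.
have nle k u : 0 < u <= 1 -> minor_norm k (word w) `^ u <=
    \sum_(J : {set 'I_n.+1} | #|J| == k) \sum_(K : {set 'I_n.+1} | #|K| == k)
      `|minor k (word w) J K| `^ u.
  move=> u01; apply: le_trans.
    by apply: powR_sum_le u01 _ => J; apply: sumr_ge0.
  by apply: ler_sum => J _; apply: powR_sum_le.
apply: (@le_trans _ _ (\sum_(a | valid a) \sum_(b | valid b) entry (word w) a b)).
  rewrite (eq_bigr (fun a => (\sum_(K : {set 'I_n.+1} | #|K| == m)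
      `|minor m (word w) a.1 K| `^ (1 - t)) *
    (\sum_(K : {set 'I_n.+1} | #|K| == m.+1)
      `|minor m.+1 (word w) a.2 K| `^ t))); last first.
    move=> a va; rewrite -sum_pairM; apply: eq_bigr => b vb.
    by rewrite /entry va (vb : valid b).
  rewrite (sum_pairM (fun L : {set 'I_n.+1} => #|L| == m)
    (fun L : {set 'I_n.+1} => #|L| == m.+1)
    (fun J => \sum_(K : {set 'I_n.+1} | #|K| == m) `|minor m (word w) J K| `^ (1 - t))
    (fun J => \sum_(K : {set 'I_n.+1} | #|K| == m.+1) `|minor m.+1 (word w) J K| `^ t)).
  by rewrite ler_pM ?powR_ge0 // nle.
rewrite [leRHS](bigID valid) /=; apply: ler_wpDr.
  by apply: sumr_ge0 => a _; apply: sumr_ge0.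
apply: ler_sum => a _; rewrite [leRHS](bigID valid) /= lerDl.
exact: sumr_ge0.
Qed.

Let flag_exists : exists p, flag p.
Proof.
pose J : {set 'I_n.+1} := (fun i : 'I_m => widen_ord (ltnW m_le_n) i) @: 'I_m.
exists (J, Ordinal m_le_n); apply/andP; split => /=.
  rewrite card_imset ?card_ord // => i j /(congr1 val) /= e; exact: val_inj.
apply/imsetP => -[i _ /(congr1 val) /= e].
by have := ltn_ord i; rewrite -e ltnn.
Qed.

(** Given a word, take the [m]-set with the largest product of diagonal entries
    and adjoin the largest remaining entry: no pair of an [m]-set and an
    [m.+1]-set does better. *)
Let pair_le_flag w (a : Pair) : valid a -> exists2 p, flag p &
  (\prod_(j in a.1) D w j) `^ (1 - t) * (\prod_(j in a.2) D w j) `^ t <=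
  (\prod_(l in p.1) D w l) * D w p.2 `^ t.
Proof.
move=> /andP[a1m /eqP a2m].
have [J Jm Jmax] : exists2 J : {set 'I_n.+1}, #|J| == m &
    forall K : {set 'I_n.+1}, #|K| == m -> \prod_(j in K) D w j <= \prod_(j in J) D w j.
  case: (@Order.TotalTheory.arg_maxP _ _ _ a.1 (fun J : {set 'I_n.+1} => #|J| == m)
    (fun J : {set 'I_n.+1} => \prod_(j in J) D w j) a1m) => J Jm Jmax.
  by exists J.
have extra (K : {set 'I_n.+1}) : #|K| = m.+1 -> exists2 k, k \in K & k \notin J.
  move=> Km; have /fintype.subsetPn[k kK kJ] : ~~ (K \subset J).
    apply/negP => /subset_leq_card.
    by rewrite Km (eqP Jm) ltnn.
  by exists k.
have [j0 _ j0J] := extra _ a2m.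
have [j jJ jmax] : exists2 j, j \notin J & forall k, k \notin J -> D w k <= D w j.
  case: (@Order.TotalTheory.arg_maxP _ _ _ j0 (fun j => j \notin J) (D w) j0J).
  by move=> j jJ jmax; exists j.
exists (J, j); first by rewrite /flag Jm jJ.
rewrite -[leRHS]powR_flag //= ler_pM ?powR_ge0 //.
  by apply: ge0_ler_powR; rewrite ?nnegrE ?Jmax // ltW.
apply: ge0_ler_powR;
  rewrite ?nnegrE ?(ltW t0) ?mulr_ge0 ?(ltW (prodD_gt0 _ _)) ?(ltW (D_gt0 _ _)) //.
have [k kK kJ] := extra _ a2m.
rewrite (big_setD1 k kK) /= mulrC ler_pM ?(ltW (prodD_gt0 _ _)) ?(ltW (D_gt0 _ _)) ?jmax //.
apply: Jmax; rewrite -eqSS -a2m (cardsD1 k a.2) kK; exact: eqxx.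
Qed.

Let flag_sum_gt0 p : 0 < flag_sum p.
Proof.
have /card_gt0P[i0 _] := I_gt0.
have term i : 0 < (\prod_(l in p.1) d i l) * d i p.2 `^ t.
  by rewrite mulr_gt0 ?powR_gt0 // prodr_gt0.
rewrite /flag_sum (bigD1 i0) //= ltr_pwDl //.
by apply: sumr_ge0 => i _; apply: ltW.
Qed.

(** Both sides grow like the [k]-th power of their growth rates when summed over
    the words of length [k], so a comparison word by word compares the rates. *)
Let pair_sum_le_flag (a : Pair) rho : valid a ->
  (forall q, flag q -> flag_sum q <= rho) ->
  \sum_i (\prod_(j in a.1) d i j) `^ (1 - t) * (\prod_(j in a.2) d i j) `^ t
    <= rho.
Proof.
move=> va le_rho; have [p0 fp0] := flag_exists.
have rho0 : 0 < rho := lt_le_trans (flag_sum_gt0 p0) (le_rho _ fp0).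
pose N : R := #|flag|%:R.
have N0 : 0 < N by rewrite ltr0n; apply/card_gt0P; exists p0.
apply: (exp_growth_le rho0 N0) => k; rewrite -sum_tuple_prod.
apply: (@le_trans _ _ (\sum_(w : k.-tuple I) \sum_(p | flag p)
    \prod_(i <- w) ((\prod_(l in p.1) d i l) * d i p.2 `^ t))).
  apply: ler_sum => w _; rewrite big_split /= -!powR_prod; first last.
  - by move=> i; apply: prodr_ge0 => j _; apply: ltW.
  - by move=> i; apply: prodr_ge0 => j _; apply: ltW.
  rewrite -!prodD_exchange; have [p fp le] := pair_le_flag w va.
  apply: (le_trans le); rewrite (bigD1 p) //= flag_word lerDl.
  apply: sumr_ge0 => q _; rewrite flag_word mulr_ge0 ?powR_ge0 //.
  exact/ltW/prodD_gt0.
rewrite exchange_big /=; apply: (@le_trans _ _ (\sum_(p | flag p) rho ^+ k)).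
  apply: ler_sum => p fp; rewrite sum_tuple_prod lerXn2r ?nnegrE ?(ltW rho0) //.
    exact/ltW/flag_sum_gt0.
  exact: le_rho.
by rewrite sumr_const -[leLHS]mulr_natl.
Qed.

Lemma flag_growth : exists p, [/\ flag p, 0 < flag_sum p,
  forall q, flag q -> flag_sum q <= flag_sum p,
  forall k, flag_sum p ^+ k <= Z k &
  forall r, flag_sum p < r -> exists C, forall k, Z k <= C * r ^+ k].
Proof.
have [p0 fp0] := flag_exists.
have [p fp pmax] : exists2 p, flag p & forall q, flag q -> flag_sum q <= flag_sum p.
  case: (@Order.TotalTheory.arg_maxP _ _ _ p0 flag flag_sum fp0) => p fp pmax.
  by exists p.
exists p; split=> // [k|r pr]; first exact: flag_sum_le_growth.
have [|||||||C HC] := @triangular_growth R I Pair (fun i => entry (T i))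
  (fun w => entry (word w)) height (flag_sum p) r _ _ _ _ _ _ _ pr.
- by move=> i a b; apply: entry_ge0.
- by move=> w a b; apply: entry_ge0.
- by move=> a b; rewrite /word big_nil; apply: entry1.
- by move=> i w a b; rewrite /word big_cons; apply: entryM.
- exact: entry_height.
- move=> a; have [va|nva] := boolP (valid a); last first.
    rewrite big1 ?(ltW (flag_sum_gt0 p)) // => i _.
    by rewrite /entry (negPf nva).
  apply: le_trans (pair_sum_le_flag va pmax); apply: ler_sum => i _.
  rewrite /entry va /=; case/andP: va => /eqP a1 /eqP a2.
  by rewrite !T_minor_diag.
- exact: ltW.
exists C => k; apply: le_trans (HC k); apply: ler_sum => w _.
exact: growth_le_entries.
Qed.

End Triangular.

(** * The pressure at non-integral points *)

Section PressureFormula.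
Variables (R : realType) (n : nat) (I : finType).
Implicit Types (A T : I -> 'M[R]_n.+1).

Lemma word_mx_conj A T (B : 'M[R]_n.+1) k (w : k.-tuple I) : B \in unitmx ->
  (forall i, A i = B *m T i *m invmx B) ->
  word_mx A w = B *m word_mx T w *m invmx B.
Proof.
move=> Bu AE; rewrite /word_mx; case: w => w /= _; elim: w => [|i w IH].
  by rewrite !big_nil mulmx1 mulmxV.
by rewrite !big_cons IH AE !mulmxA mulmxKV.
Qed.

(** Submultiplicativity of [minor_norm], for [B] and for its inverse. *)
Lemma sigma_prod_conj m (B : 'M[R]_n.+1) : (m <= n.+1)%N -> B \in unitmx ->
  exists2 K : R, 0 < K & forall M,
    \prod_(j < m) sigma (B *m M *m invmx B) j <= K * minor_norm m M /\
    minor_norm m M <= K * \prod_(j < m) sigma (B *m M *m invmx B) j.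
Proof.
move=> mn Bu; pose b := minor_norm m B; pose b' := minor_norm m (invmx B).
have b0 : 0 <= b := minor_norm_ge0 m B.
have b'0 : 0 <= b' := minor_norm_ge0 m (invmx B).
pose c : R := #|{set 'I_n.+1}|%:R ^+ 3.
have c0 : 0 <= c by rewrite exprn_ge0.
have bb0 : 0 <= b * b' by rewrite mulr_ge0.
have bbc0 : 0 <= b * b' * c by rewrite mulr_ge0.
exists (1 + b * b' + b * b' * c) => [|M]; first by rewrite !ltr_wpDr.
have /andP[lo hi] := minor_norm_sigma (B *m M *m invmx B) mn.
set phi := \prod_(j < m) _ in lo hi *.
have phi0 : 0 <= phi by apply: prodr_ge0 => j _; apply: sigma_ge0.
have M0 := minor_norm_ge0 m M.
split.
  apply: (le_trans lo); apply: (@le_trans _ _ (b * b' * minor_norm m M)).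
    apply: le_trans (minor_normM _ _ _) _; rewrite mulrAC ler_wpM2r //.
    exact: minor_normM.
  by rewrite ler_wpM2r //; lra.
have ME : M = invmx B *m (B *m M *m invmx B) *m B by rewrite !mulmxA mulVmx // mul1mx mulmxKV.
apply: (@le_trans _ _ (b * b' * c * phi)); last by rewrite ler_wpM2r //; lra.
rewrite {1}ME; apply: le_trans (minor_normM _ _ _) _.
rewrite -/b [leLHS]mulrC (_ : _ * phi = b * (b' * (c * phi))); last by ring.
rewrite ler_wpM2l //.
apply: le_trans (minor_normM _ _ _) _; by rewrite -/b' ler_wpM2l.
Qed.

Lemma sv_function_prod m (t : R) (M : 'M[R]_n.+1) : 0 < t < 1 ->
  sv_function (m%:R + t) M =
  (\prod_(j < m) sigma M j) `^ (1 - t) * (\prod_(j < m.+1) sigma M j) `^ t.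
Proof.
move=> /andP[t0 t1]; have tr : Num.truncn (m%:R + t) = m.
  by apply: truncn_def; rewrite lerDl ltW //= -natr1 ltrD2l.
rewrite /sv_function tr addrAC subrr add0r big_ord_recr /=.
have phi0 : 0 <= \prod_(j < m) sigma M j by apply: prodr_ge0 => j _; apply: sigma_ge0.
rewrite powRM ?sigma_ge0 // mulrA; have [->|nz] := eqVneq (\prod_(j < m) sigma M j) 0.
  by rewrite [0 `^ t]powR0 ?gt_eqF // mulr0 !mul0r.
by rewrite -powRD ?subrK ?powRr1 ?nz ?implybT.
Qed.

(** The sums over words of the singular value function and of the powers of
    minors of the triangular matrices have the same growth rate, since their
    terms are comparable up to the constant [K]. *)
Lemma pressure_triangular A T (B : 'M[R]_n.+1) (ht : 'I_n.+1 -> nat) m (t : R) :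
  B \in unitmx -> (forall i, A i = B *m T i *m invmx B) -> injective ht ->
  (forall i a b, T i a b != 0 -> (ht a <= ht b)%N) ->
  (forall i a, T i a a != 0) -> (0 < #|I|)%N -> (m < n.+1)%N -> 0 < t < 1 ->
  exists p, [/\ flag m p, 0 < flag_sum T t p,
    forall q, flag m q -> flag_sum T t q <= flag_sum T t p &
    pressure A (m%:R + t) = ln (flag_sum T t p)].
Proof.
move=> Bu AE hti htm Td I0 mn t01.
have [p [fp p0 pmax lower upper]] := flag_growth hti htm Td mn t01 I0.
have [K1 K10 HK1] := sigma_prod_conj (ltnW mn) Bu.
have [K2 K20 HK2] := sigma_prod_conj mn Bu.
have /andP[t0 t1] := t01.
pose K := K1 `^ (1 - t) * K2 `^ t.
have K0 : 0 < K by rewrite mulr_gt0 ?powR_gt0.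
pose z k (w : k.-tuple I) := minor_norm m (word_mx T w) `^ (1 - t) *
  minor_norm m.+1 (word_mx T w) `^ t.
have mono (u x y : R) : 0 < u -> 0 <= x -> x <= y -> x `^ u <= y `^ u.
  by move=> u0 x0 xy; apply: ge0_ler_powR; rewrite ?nnegrE ?(ltW u0) // (le_trans x0).
have phi0 k (M : 'M[R]_n.+1) : 0 <= \prod_(j < k) sigma M j.
  by apply: prodr_ge0 => j _; apply: sigma_ge0.
have up k (w : k.-tuple I) : sv_function (m%:R + t) (word_mx A w) <= K * z k w.
  rewrite sv_function_prod // (word_mx_conj w Bu AE) /z /K mulrACA.
  have [h1 _] := HK1 (word_mx T w); have [h2 _] := HK2 (word_mx T w).
  by rewrite -!powRM ?minor_norm_ge0 ?(ltW K10) ?(ltW K20) // ler_pM ?powR_ge0 // mono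
    ?subr_gt0.
have low k (w : k.-tuple I) : z k w <= K * sv_function (m%:R + t) (word_mx A w).
  rewrite sv_function_prod // (word_mx_conj w Bu AE) /z /K mulrACA.
  have [_ h1] := HK1 (word_mx T w); have [_ h2] := HK2 (word_mx T w).
  by rewrite -!powRM ?phi0 ?(ltW K10) ?(ltW K20) // ler_pM ?powR_ge0 // mono
    ?subr_gt0 ?minor_norm_ge0.
exists p; split=> //; rewrite /pressure ifT; last first.
  rewrite (@lt_le_trans _ _ m.+1%:R) ?ler_nat // -natr1 ltrD2l //.
apply: cvg_lim => //; apply: (growth_rate p0 (c := K^-1)); rewrite ?invr_gt0 //.
  move=> k; rewrite ler_pdivrMl //; apply: (le_trans (lower k)); rewrite mulr_sumr.
  by apply: ler_sum => w _; apply: low.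
move=> r /upper[C HC]; exists (K * C) => k; rewrite -mulrA.
apply: (@le_trans _ _ (K * \sum_(w : k.-tuple I) z k w)).
  by rewrite mulr_sumr; apply: ler_sum => w _; apply: up.
by rewrite ler_pM2l.
Qed.

End PressureFormula.

(** * Zeros of exponential sums *)

Section ExponentialSums.
Variable R : realType.
Implicit Types (l : seq (R * R)) (z : seq R).

Definition expsum l (x : R) : R := \sum_(p <- l) p.1 * expR (p.2 * x).
Definition dexpsum l : seq (R * R) := [seq (p.1 * p.2, p.2) | p <- l].

Lemma is_derive_expsum l (x : R) : is_derive x 1 (expsum l) (expsum (dexpsum l) x).
Proof.
rewrite /expsum /dexpsum big_map; elim: l => [|[c b] l IH].
  rewrite big_nil (_ : (fun _ => _) = cst 0); last first.
    by apply/funext => y; rewrite big_nil.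
  exact: is_derive_cst.
rewrite big_cons /= (_ : (fun _ => _) = (fun y => c * expR (b * y)) +
  (fun y => \sum_(p <- l) p.1 * expR (p.2 * y))); last first.
  by apply/funext => y; rewrite big_cons.
apply: is_deriveD.
have -> : c * b * expR (b * x) = c *: (expR (b * x) *: (b *: 1)).
  by rewrite /GRing.scale /= mulr1; ring.
apply: is_deriveZ; apply: is_derive1_comp.
Qed.

(** Rolle between consecutive zeros. *)
Lemma Rolle_zeros (f g : R -> R) x z : (forall y : R, is_derive y 1 f (g y)) ->
  path <%R x z -> f x = 0 -> (forall y, y \in z -> f y = 0) ->
  exists w, [/\ path <%R x w, size w = size z & forall y, y \in w -> g y = 0].
Proof.
move=> fg; elim: z x => [|y z IH] x /=; first by exists [::].
move=> /andP[xy yz] fx fz.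
have fy : f y = 0 by apply: fz; rewrite mem_head.
have [w [yw sw gw]] := IH y yz fy (fun u uz => fz u (mem_behead (s := y :: z) uz)).
have [c cxy [_ gc]] : exists2 c, c \in `]x, y[ & is_derive c 1 f 0.
  apply: Rolle => //; last by rewrite fx fy.
  apply: continuous_subspaceT => u.
  by apply: differentiable_continuous; apply/derivable1_diffP; case: (fg u).
move: cxy; rewrite in_itv /= => /andP[xc cy].
exists (c :: w); split => /=; last first.
- by move=> u; rewrite inE => /orP[/eqP ->|/gw //]; case: (fg c) => _ <-.
- by rewrite sw.
rewrite xc /=; case: w yw {sw gw} => //= u w /andP[yu ->].
by rewrite (lt_trans cy yu).
Qed.

(** Dividing by one exponential and differentiating loses one term and, by Rolle,
    at most one zero. *)
Lemma expsum_zeros l z : sorted <%R z -> size z = size l ->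
  (forall x, x \in z -> expsum l x = 0) -> forall x, expsum l x = 0.
Proof.
have [k] := ubnP (size l); elim: k l z => // k IH [|[c b] l] z /=.
  by move=> _ _ _ _ x; rewrite /expsum big_nil.
rewrite ltnS => lk; case: z => // y z /= yz [sz] z0.
pose l' := [seq (p.1, p.2 - b) | p <- l].
pose h x := c + expsum l' x.
have hE x : expsum ((c, b) :: l) x = h x * expR (b * x).
  rewrite /h /expsum big_cons /l' big_map mulrDl; congr (_ + _).
  rewrite mulr_suml; apply: eq_bigr => p _ /=.
  by rewrite -mulrA -expRD mulrBl subrK.
have h0 x : x \in y :: z -> h x = 0.
  move=> /z0; rewrite hE => /eqP; rewrite mulf_eq0 expR_eq0 orbF.
  by move/eqP.
have dh (x : R) : is_derive x 1 h (expsum (dexpsum l') x).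
  rewrite -[expsum _ _]add0r; apply: is_deriveD; exact: is_derive_expsum.
have [w [yw sw w0]] := Rolle_zeros dh yz (h0 _ (mem_head _ _))
   (fun u uz => h0 u (mem_behead (s := y :: z) uz)).
have d0 : forall x, expsum (dexpsum l') x = 0.
  apply: (IH _ w) => //; rewrite ?size_map //; first exact: path_sorted yw.
  by rewrite sw sz.
move=> x; have hxy : h x = h y.
  by apply: is_derive_0_is_cst => u; rewrite -(d0 u).
by rewrite hE hxy h0 ?mem_head // mul0r.
Qed.

(** A duplicate-free list of points of [P] that has maximal length exhausts [P]. *)
Lemma bounded_enumeration (T : eqType) (P : T -> Prop) N :
  (forall s : seq T, uniq s -> (forall x, x \in s -> P x) -> (size s <= N)%N) ->
  exists2 s : seq T, (size s <= N)%N & forall x, P x -> x \in s.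
Proof.
move=> H; pose Q k := `[< exists s : seq T, [/\ uniq s, size s = k &
  forall x, x \in s -> P x] >].
have Q0 : exists k, Q k by exists 0%N; apply/asboolP; exists [::].
have Qb k : Q k -> (k <= N)%N by move=> /asboolP[s [us <- sP]]; apply: H.
case: (ex_maxnP Q0 Qb) => k /asboolP[s [us sk sP]] kmax.
exists s; first by apply: H.
move=> x Px; apply: contraT => xs; suff : (k.+1 <= k)%N by rewrite ltnn.
apply: kmax; apply/asboolP; exists (x :: s); split; rewrite /= ?xs ?sk //.
by move=> y; rewrite inE => /orP[/eqP ->|/sP].
Qed.

Lemma expsum_zero_list l : (exists x, expsum l x != 0) ->
  exists2 z, (size z <= (size l).-1)%N & forall x, expsum l x = 0 -> x \in z.
Proof.
move=> [x0 nz]; apply: bounded_enumeration => s us s0.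
have l0 : (0 < size l)%N.
  by case: l nz {s0} => //; rewrite /expsum big_nil eqxx.
rewrite -ltnS prednK // ltnNge; apply/negP => le.
case/eqP: nz; apply: (@expsum_zeros l (sort <=%R (take (size l) s))).
- by rewrite lt_sorted_uniq_le sort_uniq take_uniq // sort_sorted //; apply: le_total.
- by rewrite size_sort size_takel.
- by move=> x; rewrite mem_sort => /mem_take; apply: s0.
Qed.

End ExponentialSums.

(** * Analyticity of the logarithm of an exponential sum *)

Section PowerSeries.
Variable R : realType.
Implicit Types (a b c h : nat -> R) (u : R).

Lemma cvg_pseries_geometric a (C r u : R) : (forall k, `|a k| <= C * r ^+ k) ->
  0 <= r -> r * `|u| < 1 -> cvgn (pseries a u).
Proof.
move=> aC r0 ru; apply: normed_cvg.
have C0 : 0 <= C by have := aC 0%N; rewrite expr0 mulr1; apply: le_trans.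
apply: (@series_le_cvg _ _ (geometric C (r * `|u|))) => /= [k|k|k|].
- exact: normr_ge0.
- by rewrite mulr_ge0 // exprn_ge0 // mulr_ge0.
- by rewrite normrM normrX exprMn mulrA ler_wpM2r ?exprn_ge0.
- by apply: is_cvg_geometric_series; rewrite ger0_norm // mulr_ge0.
Qed.

Lemma pseries_diffs_bound a (C r : R) : (forall k, `|a k| <= C * r ^+ k) -> 0 <= r ->
  forall k, `|pseries_diffs a k| <= C * r * (2 * r) ^+ k.
Proof.
move=> aC r0 k; rewrite /pseries_diffs normrM ger0_norm // exprMn.
have C0 : 0 <= C by have := aC 0%N; rewrite expr0 mulr1; apply: le_trans.
rewrite mulrCA -mulrA -exprS ler_pM // -natrX ler_nat.
exact: ltn_expl.
Qed.

Lemma sum_triangle (F : nat -> nat -> R) N :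
  \sum_(k < N) \sum_(j < k.+1) F j (k - j)%N =
  \sum_(i < N) \sum_(j < N - i) F i j.
Proof.
elim: N => [|N IH]; first by rewrite !big_ord0.
rewrite big_ord_recr /= IH [RHS]big_ord_recr /= subSnn big_ord1.
rewrite big_ord_recr /= subnn addrA -big_split /=; congr (_ + _).
by apply: eq_bigr => i _; rewrite subSn ?big_ord_recr // ltnW.
Qed.

(** The two partial products differ by the terms of index [i, j < n] with
    [n <= i + j], which geometric bounds make negligible. *)
Lemma Cauchy_product a b c (A B r u sa sb : R) :
  (forall k, `|a k| <= A * r ^+ k) -> (forall k, `|b k| <= B * r ^+ k) ->
  (forall k, c k = \sum_(j < k.+1) a j * b (k - j)%N) ->
  0 <= r -> r * `|u| <= 8^-1 ->
  (pseries a u @ \oo --> sa)%classic -> (pseries b u @ \oo --> sb)%classic ->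
  (pseries c u @ \oo --> sa * sb)%classic.
Proof.
move=> aA bB cE r0 ru ca cb.
have A0 : 0 <= A by have := aA 0%N; rewrite expr0 mulr1; apply: le_trans.
have B0 : 0 <= B by have := bB 0%N; rewrite expr0 mulr1; apply: le_trans.
set q := r * `|u| in ru; have q0 : 0 <= q by rewrite mulr_ge0.
have q1 : q <= 1 by apply: (le_trans ru); lra.
pose D n := pseries a u n * pseries b u n - pseries c u n.
have bnd x X : (forall k, `|x k| <= X * r ^+ k) ->
    forall k, `|x k * u ^+ k| <= X * q ^+ k.
  by move=> H k; rewrite normrM normrX exprMn mulrA ler_wpM2r ?exprn_ge0.
have DE n : D n = \sum_(i < n) \sum_(n - i <= j < n) (a i * u ^+ i) * (b j * u ^+ j).
  rewrite /D /pseries /series /= !big_mkord.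
  rewrite [X in _ - X](_ : _ = \sum_(k < n) \sum_(j < k.+1)
     (a j * u ^+ j) * (b (k - j)%N * u ^+ (k - j)%N)); last first.
    apply: eq_bigr => k _; rewrite cE mulr_suml; apply: eq_bigr => j _.
    by rewrite mulrACA -exprD subnKC // -ltnS.
  rewrite (sum_triangle (fun i j => (a i * u ^+ i) * (b j * u ^+ j))).
  rewrite mulr_suml -sumrB; apply: eq_bigr => i _.
  rewrite -!mulr_sumr -mulrBr; congr (_ * _).
  rewrite -2!(big_mkord xpredT (fun j => b j * u ^+ j)).
  by rewrite (@big_cat_nat _ _ _ (n - i)%N 0%N n) ?leq_subr //= addrAC subrr add0r.
have Dle n : `|D n| <= A * B * 2^-1 ^+ n.
  rewrite DE; apply: le_trans (ler_norm_sum _ _ _) _.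
  apply: (@le_trans _ _ (\sum_(i < n) \sum_(n - i <= j < n) A * B * q ^+ n)).
    apply: ler_sum => i _; apply: le_trans (ler_norm_sum _ _ _) _.
    rewrite big_nat_cond [leRHS]big_nat_cond; apply: ler_sum => j /andP[/andP[ij _] _].
    rewrite normrM; apply: (@le_trans _ _ ((A * q ^+ i) * (B * q ^+ j))).
      by rewrite ler_pM // bnd.
    rewrite mulrACA -exprD ler_wpM2l ?mulr_ge0 // ler_wiXn2l //.
    by rewrite -leq_subLR.
  apply: (@le_trans _ _ (\sum_(i < n) A * B * q ^+ n *+ n)).
    apply: ler_sum => i _; rewrite sumr_const_nat ler_wpMn2l ?mulr_ge0 ?exprn_ge0 //.
    by rewrite leq_subr.
  rewrite sumr_const card_ord -mulr_natr -[_ *+ n]mulr_natr -2!mulrA.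
  rewrite ler_wpM2l ?mulr_ge0 //.
  apply: (@le_trans _ _ (8^-1 ^+ n * (2 ^+ n * 2 ^+ n))).
    have n2 : n%:R <= 2 ^+ n :> R by rewrite -natrX ler_nat ltnW // ltn_expl.
    apply: ler_pM; rewrite ?exprn_ge0 ?mulr_ge0 //; last exact: ler_pM.
    by apply: lerXn2r => //; rewrite nnegrE; lra.
  by rewrite -!exprMn; apply: lerXn2r; rewrite ?nnegrE; lra.
have cD : (D @ \oo --> (0 : R))%classic.
  apply/norm_cvg0P; apply: (@squeeze_cvgr _ _ _ _ (cst 0) (geometric (A * B) 2^-1)).
  - by apply: nearW => n /=; rewrite normr_ge0 Dle.
  - exact: cvg_cst.
  - by apply: cvg_geometric; rewrite ger0_norm; lra.
have -> : pseries c u = (fun n => pseries a u n * pseries b u n - D n).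
  by apply/funext => n; rewrite /D opprB addrC subrK.
by rewrite -[sa * sb]subr0; apply: cvgB => //; apply: cvgM.
Qed.

(** [H k] computes the first [k] values, and later stages never change them. *)
Lemma strong_recursion (F : nat -> (nat -> R) -> R) :
  (forall k v w, (forall j, (j < k)%N -> v j = w j) -> F k v = F k w) ->
  exists h, forall k, h k = F k h.
Proof.
move=> Floc; pose H := fix H k := if k is k'.+1 then fun j => F j (H k') else fun=> 0.
have stable k k' j : (j < k)%N -> (j < k')%N -> H k j = H k' j.
  elim: k k' j => // k IH [|k'] j //= jk jk'; apply: Floc => i ij.
  by apply: IH; apply: (leq_trans ij).
exists (fun j => H j.+1 j) => k; apply: (Floc k (H k)) => j jk.
exact: (stable k j.+1).
Qed.

Lemma is_derive_ln_comp (f : R -> R) (x df : R) : is_derive x 1 f df -> 0 < f x ->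
  is_derive x 1 (fun y => ln (f y)) (df / f x).
Proof.
move=> dfx fx; have dl := is_derive1_ln fx.
rewrite mulrC; exact: (is_derive1_comp dl dfx).
Qed.

(** The mean value theorem on the segment between [0] and [u]. *)
Lemma vanishing_derivative (f : R -> R) (K u : R) : 0 < K ->
  (forall v, `|v| < K -> is_derive v (1 : R) f 0) -> f 0 = 0 -> `|u| < K -> f u = 0.
Proof.
move=> K0 df f0 uK.
have cst (s t : R) : s <= t -> `|s| < K -> `|t| < K -> f t = f s.
  move=> ab aK bK; have inK v : v \in `[s, t] -> `|v| < K.
    rewrite in_itv /= => /andP[av vb]; move: aK bK; rewrite !ltr_norml.
    by move=> /andP[aK _] /andP[_ bK]; apply/andP; split; lra.
  have [v vab| |c _] := @MVT_segment R f (fun=> 0) s t ab.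
  - apply/df/inK; exact: (subset_itv_oo_cc vab).
  - apply: continuous_in_subspaceT => v; rewrite inE => vab.
    apply: differentiable_continuous; apply/derivable1_diffP.
    by case: (df v (inK _ vab)).
  - by rewrite mul0r => /eqP; rewrite subr_eq0 => /eqP.
have [u0|u0] := leP 0 u; first by rewrite (cst 0 u) ?normr0.
by rewrite -(cst u 0) ?normr0 // ltW.
Qed.

(** A positive function that is locally the sum of its Taylor series, with
    geometric bounds on the coefficients, has an analytic logarithm: the
    equation [(ln g)' * g = g'] determines the coefficients of [(ln g)']
    recursively and bounds them geometrically. *)
Lemma real_analytic_ln (g dg : R -> R) (G : nat -> R) (x beta : R) :
  (forall y, 0 < g y) -> (forall y : R, is_derive y 1 g (dg y)) -> 1 <= beta ->
  (forall k, `|G k| <= G 0%N * beta ^+ k) ->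
  (forall k, `|pseries_diffs G k| <= G 0%N * beta ^+ k.+1) ->
  (forall u, (pseries G u @ \oo --> g (x + u))%classic) ->
  (forall u, (pseries (pseries_diffs G) u @ \oo --> dg (x + u))%classic) ->
  real_analytic_at (fun y => ln (g y)) x.
Proof.
move=> g0 dgE b1 Gb dGb cG cdG.
have b0 : 0 < beta := lt_le_trans ltr01 b1.
have pseries0 c : (pseries c 0 @ \oo --> c 0%N)%classic.
  apply: cvg_near_cst; near=> n; have n0 : (0 < n)%N by near: n; exists 1%N.
  rewrite /pseries /series /= -(prednK n0) big_nat_recl //= expr0 mulr1.
  by rewrite big1 ?addr0 // => i _; rewrite expr0n mulr0.
have G0E : G 0%N = g x by have := cvg_unique _ (pseries0 G) (cG 0); rewrite addr0; apply.
have G0 : 0 < G 0%N by rewrite G0E.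
have [h hE] : exists h, forall k, h k =
    (pseries_diffs G k - \sum_(j < k) G j.+1 * h (k - j.+1)%N) / G 0%N.
  apply: (strong_recursion (F := fun k v => (pseries_diffs G k -
    \sum_(j < k) G j.+1 * v (k - j.+1)%N) / G 0%N)) => k v w vw.
  congr ((_ - _) / _); apply: eq_bigr => j _; rewrite vw //.
  by rewrite ltn_subrL (leq_trans _ (ltn_ord j)).
have prod k : pseries_diffs G k = \sum_(j < k.+1) G j * h (k - j)%N.
  rewrite big_ord_recl /= subn0 hE mulrC divfK ?gt_eqF // subrK.
  by [].
have sum3 k : 2 * \sum_(j < k) (3 : R) ^+ (k - j.+1) <= 3 ^+ k.
  rewrite (reindex_inj rev_ord_inj) /=.
  rewrite (eq_bigr (fun j : 'I_k => 3 ^+ j)); last first.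
    by move=> j _; rewrite subnSK // subKn // ltnW.
  elim: k => [|k IH]; first by rewrite big_ord0 mulr0 expr0.
  by rewrite big_ord_recr /= exprS mulrDr; lra.
(* The recursion multiplies the previous bounds by a geometric tail; the factor
   [3] in the ratio makes the tail at most one half. *)
have hb k : `|h k| <= 2 * beta * (3 * beta) ^+ k.
  have [N] := ubnP k; elim: N k => // N IH k; rewrite ltnS => kN.
  rewrite hE normrM normfV (ger0_norm (ltW G0)) ler_pdivrMr //.
  apply: le_trans (ler_normB _ _) _.
  apply: (@le_trans _ _ (G 0%N * beta ^+ k.+1 + \sum_(j < k)
      G 0%N * (2 * beta) * (beta ^+ k * 3 ^+ (k - j.+1)))).
    apply: lerD; first exact: dGb.
    apply: le_trans (ler_norm_sum _ _ _) _; apply: ler_sum => j _.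
    have jk : (k - j.+1 < k)%N by rewrite ltn_subrL (leq_trans _ (ltn_ord j)).
    rewrite normrM; apply: (@le_trans _ _ ((G 0%N * beta ^+ j.+1) *
        (2 * beta * (3 * beta) ^+ (k - j.+1)))).
      by rewrite ler_pM // IH // (leq_trans jk).
    have -> : beta ^+ k = beta ^+ j.+1 * beta ^+ (k - j.+1).
      by rewrite -exprD subnKC.
    rewrite exprMn le_eqVlt; apply/orP; left; apply/eqP; ring.
  rewrite -mulr_sumr -mulr_sumr exprMn exprS.
  have := sum3 k; set S := \sum_(j < k) _ => S3.
  have bk : 0 <= G 0%N * (beta * beta ^+ k).
    by rewrite !mulr_ge0 ?exprn_ge0 ?(ltW b0) // ltW.
  have t1 : 1 <= (3 : R) ^+ k by rewrite exprn_ege1 //; lra.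
  have -> : G 0%N * (beta * beta ^+ k) + G 0%N * (2 * beta) * (beta ^+ k * S) =
    G 0%N * (beta * beta ^+ k) * (1 + 2 * S) by ring.
  have -> : 2 * beta * (3 ^+ k * beta ^+ k) * G 0%N =
    G 0%N * (beta * beta ^+ k) * (2 * 3 ^+ k) by ring.
  by rewrite ler_wpM2l //; lra.
(* The candidate Taylor coefficients of [ln g], whose derivative is [h]. *)
pose c k := if k is k'.+1 then h k' / k'.+1%:R else ln (G 0%N).
have dc : pseries_diffs c = h.
  by apply/funext => k; rewrite /pseries_diffs /c mulrC divfK.
pose gam := 3 * beta; have gam0 : 0 < gam by rewrite mulr_gt0.
have gam1 : 1 <= gam by rewrite /gam; lra.
pose M := `|ln (G 0%N)| + 2 * beta.
have cb k : `|c k| <= M * gam ^+ k.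
  case: k => [|k] /=; first by rewrite expr0 mulr1 lerDl mulr_ge0 // ltW.
  rewrite normf_div normr_nat ler_pdivrMr ?ltr0Sn //.
  apply: (le_trans (hb k)); apply: (@le_trans _ _ (M * gam ^+ k.+1)).
    rewrite ler_pM ?exprn_ge0 ?mulr_ge0 ?(ltW b0) ?(ltW gam0) //.
      by rewrite lerDr.
    exact: ler_weXn2l.
  rewrite ler_peMr ?ler1n // mulr_ge0 ?exprn_ge0 ?(ltW gam0) // addr_ge0 //.
  by rewrite mulr_ge0 // ltW.
(* Small enough for the Cauchy product, and for the convergence of the second
   derivative of the series, whose ratio is [4 * gam]. *)
pose K := (8 * gam)^-1; have K0 : 0 < K by rewrite invr_gt0 mulr_gt0.
have gK : gam * K = 8^-1 by rewrite /K invfM mulrCA mulfV ?mulr1 // gt_eqF.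
have small u : `|u| < K -> gam * `|u| <= 8^-1.
  by move=> uK; rewrite -gK ler_wpM2l // ltW.
have cvgc u : `|u| <= K -> cvgn (pseries c u).
  move=> uK; apply: (cvg_pseries_geometric cb (ltW gam0)).
  by apply: (@le_lt_trans _ _ (gam * K)); rewrite ?ler_wpM2l ?(ltW gam0) // gK; lra.
have dcb := pseries_diffs_bound cb (ltW gam0).
have gam20 : 0 <= 2 * gam by rewrite mulr_ge0 // ltW.
have ddcb := pseries_diffs_bound dcb gam20.
have KE : `|K| = K by rewrite ger0_norm // ltW.
have dL u : `|u| < K -> is_derive u (1 : R) (fun v => limn (pseries c v))
    (limn (pseries h u)).
  move=> uK; rewrite -dc; apply: (@pseries_snd_diffs _ c K).
  - by apply: cvgc; rewrite KE.
  - apply: (cvg_pseries_geometric dcb gam20); by rewrite KE -mulrA gK; lra.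
  - apply: (cvg_pseries_geometric ddcb); first by rewrite mulr_ge0.
    by rewrite KE -mulrA -[2 * gam * K]mulrA gK; lra.
  - by rewrite KE.
have hlim u : `|u| < K -> limn (pseries h u) = dg (x + u) / g (x + u).
  move=> uK; have ch : cvgn (pseries h u).
    apply: (cvg_pseries_geometric hb (ltW gam0)).
    by apply: (le_lt_trans (small _ uK)); lra.
  have Gb' k : `|G k| <= G 0%N * gam ^+ k.
    apply: (le_trans (Gb k)); rewrite ler_wpM2l ?(ltW G0) // lerXn2r ?nnegrE ?(ltW b0)
      ?(ltW gam0) // /gam; lra.
  have := Cauchy_product Gb' hb prod (ltW gam0) (small _ uK) (cG u) ch.
  move=> /(cvg_unique _ (cdG u)) -> //.
  by rewrite mulrC mulKf // gt_eqF.
exists c; exists K => //= y; rewrite /= distrC => yK.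
suff -> : ln (g y) = limn (pseries c (y - x)) by apply: cvgc; apply: ltW.
pose f u := ln (g (x + u)) - limn (pseries c u).
have df u : `|u| < K -> is_derive u (1 : R) f 0.
  move=> uK; rewrite -[0](subrr (limn (pseries h u))); apply: is_deriveB.
    rewrite hlim //; apply: (is_derive_ln_comp (f := fun v => g (x + v))) => //.
    rewrite -[dg _]mulr1 -[X in _ * X]add0r.
    have shift : is_derive u (1 : R) (cst x + (id : R -> R)) (0 + 1).
      exact: is_deriveD.
    exact: (is_derive1_comp (f := g) (g := fun v => x + v)).
  exact: dL.
have f0 : f 0 = 0.
  by rewrite /f addr0 (cvg_lim _ (pseries0 c)) //= G0E subrr.
suff : f (y - x) = 0 by move/eqP; rewrite /f subr_eq0 addrC subrK => /eqP.
exact: (vanishing_derivative K0 df f0).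
Unshelve. all: by end_near. Qed.

End PowerSeries.

Section LnExpsum.
Variable R : realType.
Implicit Types (l : seq (R * R)).

(** The Taylor coefficients of [expsum l] at [x]. *)
Definition taylor l (x : R) (k : nat) : R :=
  \sum_(p <- l) p.1 * expR (p.2 * x) * (p.2 ^+ k / k`!%:R).

Lemma cvg_taylor l x u : (pseries (taylor l x) u @ \oo --> expsum l (x + u))%classic.
Proof.
elim: l => [|p l IH].
  rewrite /expsum big_nil (_ : pseries _ _ = cst 0); first exact: cvg_cst.
  apply/funext => n; rewrite /pseries /series /= big1 // => k _.
  by rewrite /taylor big_nil mul0r.
rewrite /expsum big_cons -/(expsum l (x + u)).
have -> : pseries (taylor (p :: l) x) u = (fun n =>
    p.1 * expR (p.2 * x) * series (exp_coeff (p.2 * u)) n + pseries (taylor l x) u n).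
  apply/funext => n; rewrite /pseries /series /= mulr_sumr -big_split /=.
  apply: eq_bigr => k _; rewrite {1}/taylor big_cons mulrDl; congr (_ + _).
  by rewrite /exp_coeff /= exprMn; ring.
apply: cvgD => //; rewrite mulrDr expRD mulrA; apply: cvgMr.
exact: is_cvg_series_exp_coeff.
Qed.

Lemma pseries_diffs_taylor l x : pseries_diffs (taylor l x) = taylor (dexpsum l) x.
Proof.
apply/funext => k; rewrite /pseries_diffs /taylor /dexpsum big_map mulr_sumr.
apply: eq_bigr => p _ /=; rewrite factS natrM exprS invfM.
have k0 : k.+1%:R != 0 :> R by rewrite pnatr_eq0.
move: (k.+1%:R) k0 => c c0; have : k`!%:R != 0 :> R by rewrite pnatr_eq0 -lt0n fact_gt0.
by move: (k`!%:R) => f f0; field; rewrite c0 f0.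
Qed.

Lemma real_analytic_ln_expsum l x : l != [::] -> (forall p, p \in l -> 0 < p.1) ->
  real_analytic_at (fun y => ln (expsum l y)) x.
Proof.
move=> l0 lp; pose beta : R := 1 + \sum_(p <- l) `|p.2|.
have b1 : 1 <= beta by rewrite lerDl sumr_ge0.
have lb p : p \in l -> `|p.2| <= beta.
  move=> pl; rewrite /beta (big_rem p) //= addrCA lerDl addr_ge0 // sumr_ge0 //.
have g0 y : 0 < expsum l y.
  rewrite /expsum; case: l l0 lp {beta b1 lb} => // p l _ lp.
  rewrite big_cons ltr_pwDl ?mulr_gt0 ?expR_gt0 ?lp ?mem_head //.
  rewrite big_seq sumr_ge0 // => q ql; rewrite mulr_ge0 ?expR_ge0 // ltW // lp //.
  by rewrite inE ql orbT.
have T0 : taylor l x 0 = expsum l x.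
  by apply: eq_bigr => p _; rewrite expr0 fact0 divr1 mulr1.
have term p k : p \in l -> `|p.2 ^+ k / k`!%:R| <= beta ^+ k.
  move=> /lb pb; rewrite normf_div normrX normr_nat.
  rewrite ler_pdivrMr ?ltr0n ?fact_gt0 // (@le_trans _ _ (beta ^+ k)) //.
    by rewrite lerXn2r ?nnegrE // (le_trans ler01).
  by rewrite ler_peMr ?exprn_ge0 ?ler1n ?fact_gt0 // (le_trans ler01).
apply: (real_analytic_ln (g := expsum l) (dg := expsum (dexpsum l))
  (G := taylor l x) (beta := beta)) => //.
- exact: is_derive_expsum.
- move=> k; rewrite T0 {1}/taylor /expsum mulr_suml big_seq [leRHS]big_seq.
  apply: le_trans (ler_norm_sum _ _ _) _; apply: ler_sum => p pl.
  rewrite normrM (ger0_norm (x := p.1 * _)) ?mulr_ge0 ?expR_ge0 ?(ltW (lp _ pl)) //.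
  by rewrite ler_wpM2l ?term // mulr_ge0 ?expR_ge0 // ltW ?lp.
- move=> k; rewrite pseries_diffs_taylor T0 /taylor /dexpsum big_map /expsum mulr_suml.
  rewrite big_seq [leRHS]big_seq.
  apply: le_trans (ler_norm_sum _ _ _) _; apply: ler_sum => p pl /=.
  have -> : p.1 * p.2 * expR (p.2 * x) * (p.2 ^+ k / k`!%:R) =
    p.1 * expR (p.2 * x) * (p.2 * (p.2 ^+ k / k`!%:R)) by ring.
  have pe : 0 <= p.1 * expR (p.2 * x) by rewrite mulr_ge0 ?expR_ge0 // ltW ?lp.
  rewrite normrM (ger0_norm pe) ler_wpM2l // normrM exprS ler_pM ?lb ?term //.
- by move=> u; apply: cvg_taylor.
- by move=> u; rewrite pseries_diffs_taylor; apply: cvg_taylor.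
Qed.

End LnExpsum.

(** * Crossings, flags and their number *)

Section PairLists.
Variable T : eqType.

Fixpoint unordered_pairs (s : seq T) : seq (T * T) :=
  if s is x :: s' then [seq (x, y) | y <- s'] ++ unordered_pairs s' else [::].

Lemma size_unordered_pairs s : size (unordered_pairs s) = 'C(size s, 2).
Proof.
elim: s => //= x s IH; rewrite size_cat size_map IH binS bin1 addnC.
by [].
Qed.

Lemma mem_unordered_pairs s x y : x \in s -> y \in s -> x != y ->
  ((x, y) \in unordered_pairs s) || ((y, x) \in unordered_pairs s).
Proof.
elim: s => //= z s IH; rewrite !inE !mem_cat => /orP[/eqP ->|xs] /orP[/eqP ->|ys] xy.
- by rewrite eqxx in xy.
- by rewrite map_f.
- by rewrite (map_f (pair z) xs) !orbT.
- by case/orP: (IH xs ys xy) => ->; rewrite !orbT.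
Qed.

Lemma size_flatten_bound (S : eqType) (K : nat) (f : S -> seq T) (s : seq S) :
  (forall x, size (f x) <= K)%N -> (size (flatten [seq f x | x <- s]) <= size s * K)%N.
Proof.
move=> fK; elim: s => //= x s IH; rewrite size_cat mulSn.
exact: leq_add.
Qed.

End PairLists.

Section Counting.
Local Open Scope nat_scope.

Lemma card_flag n m : #|@flag n m| = 'C(n.+1, m) * (n.+1 - m).
Proof.
rewrite -sum1_card.
rewrite -(pair_big_dep (fun J : {set 'I_n.+1} => #|J| == m)
  (fun (J : {set 'I_n.+1}) j => j \notin J) (fun _ _ => 1)) /=.
rewrite (eq_bigr (fun _ => n.+1 - m)); last first.
  move=> J /eqP Jm; rewrite sum1_card; have := cardC J.
  by rewrite card_ord Jm => /(congr1 (subn^~ m)) <-; rewrite addKn; apply: eq_card.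
rewrite sum_nat_const; congr (_ * _).
by rewrite -[n.+1 in RHS]card_ord -card_draws cardsE.
Qed.

(** Two applications of the absorption identities for binomials. *)
Lemma bin_central n : n.+1 * 'C(2 * n.+1, n.+1) = 2 * (2 * n).+1 * 'C(2 * n, n).
Proof.
have -> : 2 * n.+1 = (2 * n).+2 by rewrite mulnS.
have := mul_bin_diag (2 * n).+2 n; have := mul_bin_down (2 * n).+1 n.
rewrite /= => down diag.
have e : (2 * n).+1 - n = n.+1 by rewrite mul2n -addnn -addSn addnK.
rewrite e in down.
apply/eqP; rewrite -(eqn_pmul2l (ltn0Sn n)); apply/eqP.
rewrite -diag mulnCA -down; ring.
Qed.

Lemma sum_bin n : \sum_(m < n.+1) 'C(n, m) = 2 ^ n.
Proof.
by rewrite -[2]/(1 + 1) expnDn; apply: eq_bigr => i _; rewrite !exp1n !muln1.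
Qed.

(** Vandermonde's convolution, with ['C(n, m)] written as ['C(n, n - m)]. *)
Lemma sum_bin_sqr n : \sum_(m < n.+1) 'C(n, m) ^ 2 = 'C(2 * n, n).
Proof.
rewrite mul2n -addnn -binomial.Vandermonde; apply: eq_bigr => i _.
by rewrite bin_sub // -ltnS.
Qed.

End Counting.

Lemma natr_bin2 (R : realFieldType) k : 'C(k, 2)%:R = (k%:R ^+ 2 - k%:R) / 2 :> R.
Proof.
elim: k => [|k IH]; first by rewrite expr0n subrr mul0r.
by rewrite binS bin1 natrD IH -natr1; field.
Qed.

(** There are [N * 'C(n, m)] flags, with [N = n.+1], so twice the sum is
    [N ^ 2 * 'C(2 * n, n) - N * 2 ^ n]. *)
Lemma flag_pairs_total (R : realFieldType) n :
  (\sum_(m < n.+1) 'C(#|@flag n m|, 2))%:R =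
  n.+1%:R ^+ 3 / (8 * n.+1%:R - 4) * 'C(2 * n.+1, n.+1)%:R -
  2 ^+ n.+1 * n.+1%:R / 4 :> R.
Proof.
have flagE m : #|@flag n m| = (n.+1 * 'C(n, m))%N.
  by rewrite card_flag (mul_bin_down n.+1) mulnC.
have -> : (\sum_(m < n.+1) 'C(#|@flag n m|, 2))%:R =
    (n.+1%:R ^+ 2 * 'C(2 * n, n)%:R - n.+1%:R * 2 ^+ n) / 2 :> R.
  rewrite -sum_bin_sqr -[2 ^+ n]natrX -sum_bin !natr_sum !mulr_sumr -sumrB mulr_suml.
  by apply: eq_bigr => m _; rewrite natr_bin2 flagE natrM natrX exprMn.
have := congr1 (fun k => k%:R : R) (bin_central n).
rewrite !natrM -[(2 * n).+1%:R]natr1 natrM [2 ^+ n.+1]exprS -natr1.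
move: ('C(2 * n, n)%:R : R) ('C(2 * n.+1, n.+1)%:R : R) (2 ^+ n : R) => c C e.
have n0 : (0 : R) <= n%:R := ler0n _ n.
move: (n%:R : R) n0 => x x0 H.
have -> : C = 2 * (2 * x + 1) * c / (x + 1).
  by rewrite -H mulrAC divff ?mul1r // gt_eqF //; lra.
field; apply/andP; split; rewrite gt_eqF //; lra.
Qed.

Section PhaseTransitions.
Variable R : realType.

Lemma phase_transition_subset_list (S : set R) (z : seq R) :
  (forall x, S x -> x \in z) ->
  finite_set S /\ (#|` fset_set S| <= size z)%N.
Proof.
move=> Sz; have fS : finite_set S by apply: sub_finite_set (finite_seq z) => x /Sz.
split=> //; apply: uniq_leq_size; first exact: fset_uniq.
by move=> x; rewrite in_fset_set // inE => /Sz.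
Qed.

(** The required neighbourhood is the interior of the set of positive points
    where [f] coincides with [ln (expsum l)]. *)
Lemma not_phase_transition (f : R -> R) (l : seq (R * R)) (x : R) : 0 < x -> l != [::] ->
  (forall p, p \in l -> 0 < p.1) ->
  (\forall y \near x, f y = ln (expsum l y)) -> ~ phase_transitions f x.
Proof.
move=> x0 l0 lp near_f [_]; apply.
pose P := [set y : R | 0 < y /\ f y = ln (expsum l y)]%classic.
exists (P^°)%classic; split.
- split; first exact: open_interior.
  rewrite /interior; near=> y; split; near: y => //.
  exact: lt_nbhsr.
- by move=> y /nbhs_singleton[y0 _]; rewrite /= in_itv /= andbT.
- move=> y Py; have [a Ha] := real_analytic_ln_expsum y l0 lp.
  exists a; near=> z; have [_ ->] : P z by near: z; exact: Py.
  by near: z.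
Unshelve. all: by end_near. Qed.

Lemma expsum_continuous (l : seq (R * R)) : continuous (expsum l : R -> R).
Proof.
move=> x; apply: differentiable_continuous; apply/derivable1_diffP.
by case: (is_derive_expsum l x).
Qed.

Definition expsum_sub (l l' : seq (R * R)) := l ++ [seq (- p.1, p.2) | p <- l'].

Lemma expsum_subE l l' x : expsum (expsum_sub l l') x = expsum l x - expsum l' x.
Proof.
rewrite /expsum big_cat big_map; congr (_ + _); rewrite -sumrN.
by apply: eq_bigr => p _; rewrite mulNr.
Qed.

(** A function that does not coincide everywhere with a maximal one is strictly
    smaller at [x], hence near [x] by continuity. *)
Lemma locally_maximal (X : finType) (P : pred X) (l : X -> seq (R * R)) (x : R) p0 : P p0 ->
  (forall p q, P p -> P q -> expsum (l p) x = expsum (l q) x ->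
     forall y, expsum (l p) y = expsum (l q) y) ->
  exists2 p, P p & \forall y \near x, forall q, P q -> expsum (l q) y <= expsum (l p) y.
Proof.
move=> Pp0 nocross.
have [p Pp pmax] : exists2 p, P p & forall q, P q -> expsum (l q) x <= expsum (l p) x.
  case: (@Order.TotalTheory.arg_maxP _ _ _ p0 P (fun p => expsum (l p) x) Pp0) => p Pp pmax.
  by exists p.
exists p => //; apply: (@filter_forall _ _ (fun q y => P q -> expsum (l q) y <= expsum (l p) y)
  (nbhs x) _) => q.
have [Pq|nPq] := boolP (P q); last by apply: nearW.
have := pmax _ Pq; rewrite le_eqVlt => /orP[/eqP e|lt].
  by apply: nearW => y _; rewrite (nocross _ _ Pq Pp e).
have lt0 : expsum (expsum_sub (l q) (l p)) x < 0 by rewrite expsum_subE subr_lt0.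
have near_lt := cvgr_lt _ (expsum_continuous (l := expsum_sub (l q) (l p)) (x := x)) _ lt0.
by apply: filterS (near_lt _) => y /=; rewrite expsum_subE subr_lt0 => /ltW.
Qed.

End PhaseTransitions.

Section TriangularForm.
Variables (R : realType) (n : nat) (I : finType).

Lemma triangular_diag_neq0 (T : 'M[R]_n.+1) a :
  is_trig_mx T || is_trig_mx T^T -> T \in unitmx -> T a a != 0.
Proof.
have gen (M : 'M[R]_n.+1) : is_trig_mx M -> M \in unitmx -> M a a != 0.
  move=> Mt; rewrite unitmxE unitfE det_trig // => /prodf_neq0; exact.
move=> /orP[/gen //|/gen]; rewrite unitmx_tr mxE; exact.
Qed.

(** The height is the index for upper triangular matrices and the reversed index
    for lower triangular ones. *)
Lemma triangular_form (A : I -> 'M[R]_n.+1) : (forall i, A i \in unitmx) ->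
  (forall i, is_diag_mx (A i)) \/ simultaneously_triangularisable A ->
  exists B T (ht : 'I_n.+1 -> nat), [/\ B \in unitmx,
    forall i, A i = B *m T i *m invmx B, injective ht,
    forall i a b, T i a b != 0 -> (ht a <= ht b)%N & forall i a, T i a a != 0].
Proof.
move=> Au [Ad|[B Bu tri]].
  exists 1%:M, A, (@nat_of_ord _); split.
  - exact: unitmx1.
  - by move=> i; rewrite invmx1 mul1mx mulmx1.
  - exact: ord_inj.
  - move=> i a b; apply: contraNT; rewrite -ltnNge => ba.
    by have /is_diag_mxP -> := Ad i; rewrite // neq_ltn ba orbT.
  - by move=> i a; rewrite triangular_diag_neq0 // is_diag_mx_is_trig.
pose T i := invmx B *m A i *m B.
have AE i : A i = B *m T i *m invmx B by rewrite /T !mulmxA mulmxV // mul1mx mulmxK.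
have Tu i : T i \in unitmx by rewrite !unitmx_mul unitmx_inv Bu Au.
case: tri => tri.
  exists B, T, (@nat_of_ord _); split=> //; first exact: ord_inj.
    move=> i a b; apply: contraNT; rewrite -ltnNge => ba.
    by have /is_trig_mxP /(_ _ _ ba) := tri i; rewrite mxE => ->.
  by move=> i a; rewrite triangular_diag_neq0 // [is_trig_mx _^T](tri i) orbT.
exists B, T, (fun a => rev_ord a); split=> //.
- by move=> a b /ord_inj/rev_ord_inj.
- move=> i a b; apply: contraNT; rewrite -ltnNge /= => ba.
  have /is_trig_mxP -> // := tri i.
  by move: ba; rewrite ltn_sub2lE //.
- by move=> i a; rewrite triangular_diag_neq0 // [is_trig_mx _](tri i).
Qed.

End TriangularForm.

(** * Counting the phase transitions *)

Section FlagExponentials.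
Variables (R : realType) (n : nat) (I : finType) (T : I -> 'M[R]_n.+1).
Hypothesis T_diag : forall i a, T i a a != 0.
Implicit Type p : {set 'I_n.+1} * 'I_n.+1.

(** [flag_sum T (y - m) p] as an exponential sum in [y]: the shift by [m] is
    absorbed by the coefficients. *)
Definition flag_exponential m p : seq (R * R) :=
  [seq ((\prod_(l in p.1) `|T i l l|) * expR (- m%:R * ln `|T i p.2 p.2|),
        ln `|T i p.2 p.2|) | i <- enum I].

Lemma size_flag_exponential m p : size (flag_exponential m p) = #|I|.
Proof. by rewrite size_map -cardE. Qed.

Lemma flag_exponential_pos m p q : q \in flag_exponential m p -> 0 < q.1.
Proof.
move=> /mapP[i _ ->] /=; rewrite mulr_gt0 ?expR_gt0 // prodr_gt0 // => l _.
by rewrite normr_gt0.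
Qed.

Lemma flag_sum_expsum m p y :
  flag_sum T (y - m%:R) p = expsum (flag_exponential m p) y.
Proof.
rewrite /expsum big_map big_enum /=; apply: eq_bigr => i _.
rewrite -mulrA -expRD /powR normr_eq0 (negPf (T_diag _ _)).
by congr (_ * expR _); ring.
Qed.

(** The crossings are the zeros of a difference with [2 * #|I|] terms. *)
Lemma flag_crossings m (pq : ({set 'I_n.+1} * 'I_n.+1) * ({set 'I_n.+1} * 'I_n.+1)) :
  (0 < #|I|)%N -> exists z : seq R, (size z <= 2 * #|I| - 1)%N /\
    forall x y, expsum (flag_exponential m pq.1) x = expsum (flag_exponential m pq.2) x ->
      expsum (flag_exponential m pq.1) y != expsum (flag_exponential m pq.2) y -> x \in z.
Proof.
move=> I0; case: pq => p q /=.
pose l := expsum_sub (flag_exponential m p) (flag_exponential m q).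
have [nz|z] := pselect (exists y, expsum l y != 0); last first.
  exists [::]; split=> // x y _ ne; case: z; exists y.
  by rewrite expsum_subE subr_eq0.
have [z sz zP] := expsum_zero_list nz; exists z; split.
  apply: (leq_trans sz); rewrite /l /expsum_sub size_cat [X in (_ + X)%N]size_map.
  by rewrite !size_flag_exponential addnn -mul2n subn1.
by move=> x y e _; apply: zP; rewrite expsum_subE e subrr.
Qed.

End FlagExponentials.

(** Beyond [n] the pressure is the logarithm of a single exponential sum. *)
Lemma pressure_above_dim (R : realType) n (I : finType) (A : I -> 'M[R]_n.+1) x :
  (forall i, A i \in unitmx) -> (0 < #|I|)%N -> n.+1%:R < x ->
  ~ phase_transitions (pressure A) x.
Proof.
move=> Au I0 nx.
pose l := [seq ((1 : R), ln `|\det (A i)| / n.+1%:R) | i <- enum I].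
apply: (@not_phase_transition R _ l).
- by apply: le_lt_trans nx.
- by rewrite -size_eq0 size_map -cardE -lt0n.
- by move=> q /mapP[i _ ->].
near=> y; have ny : n.+1%:R < y by near: y; apply: lt_nbhsr.
rewrite /pressure ltNge (ltW ny) /=; congr ln.
rewrite /expsum big_map big_enum /=; apply: eq_bigr => i _.
rewrite mul1r /powR normr_eq0 ifF; last first.
  by apply/negbTE; rewrite -unitfE -unitmxE.
by congr expR; rewrite mulrC mulrA mulrAC.
Unshelve. all: by end_near. Qed.

Local Open Scope classical_set_scope.
Local Open Scope ring_scope.

Theorem mainTheorem5 (R : realType) (n : nat) (I : finType)
    (A : I -> 'M[R]_n) (n_gt0 : (0 < n)%N) (I_gt0 : (0 < #|I|)%N)
    (A_unit : forall i, A i \in unitmx)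
    (A_cases : (forall i, is_diag_mx (A i)) \/
       ((forall i, contracting (A i)) /\ simultaneously_triangularisable A)) :
  finite_set (phase_transitions (pressure A)) /\
  (#|` fset_set (phase_transitions (pressure A)) |)%:R <=
    n%:R + (2 * #|I|%:R - 1) *
      (n%:R ^+ 3 / (8 * n%:R - 4) * 'C(2 * n, n)%:R - 2 ^+ n * n%:R / 4) :> R.
Proof.
case: n A n_gt0 A_unit A_cases => // n A _ A_unit A_cases.
have [||B [T [ht [Bu AE hti htm Td]]]] := triangular_form (A := A) => //.
  by case: A_cases => [|[_]]; [left|right].
pose X := ({set 'I_n.+1} * 'I_n.+1)%type.
pose ell m (p : X) := flag_exponential T m p.
have [zf zfP] := choice (fun mpq : nat * (X * X) =>
  flag_crossings T mpq.1 mpq.2 I_gt0).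
(* The integers [1, ..., n.+1] and the crossings of all pairs of flags. *)
pose zm m := flatten [seq zf (m, pq) | pq <- unordered_pairs (enum (@flag n m))].
pose z := [seq k.+1%:R : R | k <- iota 0 n.+1] ++ flatten [seq zm m | m <- iota 0 n.+1].
have cover x : phase_transitions (pressure A) x -> x \in z.
  move=> phx; have x0 : 0 < x by case: phx.
  apply: contraT => xz; exfalso.
  have x_int k : (k < n.+1)%N -> x <> k.+1%:R.
    move=> kn xk; case/negP: xz; rewrite mem_cat xk (map_f (fun k => k.+1%:R)) //.
    by rewrite mem_iota.
  have [nx|] := ltP n.+1%:R x; first exact: (pressure_above_dim A_unit I_gt0 nx).
  rewrite le_eqVlt => /orP[/eqP xn|xn]; first exact: (x_int n).
  pose m := Num.truncn x; have /andP[mx xm] : m%:R <= x < m.+1%:R.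
    by apply: truncn_itv; apply: ltW.
  have mn : (m < n.+1)%N by rewrite -(ltr_nat R) (le_lt_trans mx).
  have {}mx : m%:R < x.
    rewrite lt_neqAle mx andbT; apply/eqP => e.
    case: m e mn {xm mx} => [|k] e mn; first by rewrite -e ltxx in x0.
    exact: (x_int k (ltnW mn) (esym e)).
  have formula y : m%:R < y -> y < m.+1%:R -> exists p, [/\ flag m p,
      forall q, flag m q -> expsum (ell m q) y <= expsum (ell m p) y &
      pressure A y = ln (expsum (ell m p) y)].
    move=> my ym; have t01 : 0 < y - m%:R < 1.
      by rewrite subr_gt0 my ltrBlDl natr1.
    have [p [fp _ pmax pE]] := pressure_triangular Bu AE hti htm Td I_gt0 mn t01.
    exists p; split=> // [q fq|]; first by rewrite -!flag_sum_expsum // pmax.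
    by rewrite -flag_sum_expsum // -pE addrC subrK.
  have [p0 [fp0 _ _]] := formula x mx xm.
  have [|p fp near_max] := @locally_maximal R _ (@flag n m) (ell m) x p0 fp0.
    move=> p q fp fq e y; apply: contraTeq isT => ne; exfalso.
    have pq : p != q by apply: contraNneq ne => ->.
    have fpe : p \in enum (@flag n m) by rewrite mem_enum.
    have fqe : q \in enum (@flag n m) by rewrite mem_enum.
    case/negP: xz; rewrite mem_cat; apply/orP; right.
    apply/flattenP; exists (zm m); first by apply: (map_f zm); rewrite mem_iota.
    case/orP: (mem_unordered_pairs fpe fqe pq) => pqs.
      apply/flattenP; exists (zf (m, (p, q))); first exact: (map_f (fun pq => zf (m, pq)) pqs).
      by have [_ /(_ x y)] := zfP (m, (p, q)); apply.
    apply/flattenP; exists (zf (m, (q, p))); first exact: (map_f (fun pq => zf (m, pq)) pqs).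
    by have [_ /(_ x y)] := zfP (m, (q, p)); apply; rewrite // eq_sym.
  apply: (@not_phase_transition R _ (ell m p) x x0 _ _ _ phx).
  - by rewrite -size_eq0 size_flag_exponential -lt0n.
  - by move=> q; apply: flag_exponential_pos.
  near=> y.
  have pmax : forall q, flag m q -> expsum (ell m q) y <= expsum (ell m p) y.
    by near: y.
  have my : m%:R < y by near: y; apply: lt_nbhsr.
  have ym : y < m.+1%:R by near: y; apply: lt_nbhsl.
  have [q [fq qmax ->]] := formula y my ym.
  by congr ln; apply/eqP; rewrite eq_le qmax // pmax.
have [fin le] := phase_transition_subset_list cover; split=> //.
have zle : (size z <= n.+1 + (\sum_(m < n.+1) 'C(#|@flag n m|, 2)) * (2 * #|I| - 1))%N.
  rewrite /z size_cat size_map size_iota leq_add2l size_flatten /shape -map_comp.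
  rewrite sumnE big_map -[iota 0 n.+1]/(index_iota 0 n.+1) big_mkord big_distrl /=.
  apply: leq_sum => m _; rewrite [#|@flag n m|]cardE -size_unordered_pairs.
  by apply: size_flatten_bound => pq; case: (zfP (val m, pq)).
apply: (@le_trans _ _ (n.+1 +
    (\sum_(m < n.+1) 'C(#|@flag n m|, 2)) * (2 * #|I| - 1))%:R).
  by rewrite ler_nat (leq_trans le).
by rewrite natrD natrM flag_pairs_total natrB ?muln_gt0 // natrM mulrC.
Unshelve. all: by end_near. Qed.
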